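(* Let $f:\mathbb{R}^{d_1}\times\mathbb{R}^{d_2}\to\mathbb{R}$ satisfy: (i) for every fixed $x$, $\max_y f(x,y)$ has a nonempty solution set and a finite optimal value, and there is $\mu>0$ with $\|\nabla_y f(x,y)\|^2\geq 2\mu[\max_{y'}f(x,y')-f(x,y)]$ for all $x,y$; (ii) there is $l>0$ with $\|\nabla_x f(x_1,y_1)-\nabla_x f(x_2,y_2)\|\leq l[\|x_1-x_2\|+\|y_1-y_2\|]$ and $\|\nabla_y f(x_1,y_1)-\nabla_y f(x_2,y_2)\|\leq l[\|x_1-x_2\|+\|y_1-y_2\|]$ for all $x_1,x_2,y_1,y_2$. Let $\Phi(x)=\max_y f(x,y)$ and suppose $\Phi^*=\min_x\Phi(x)$ exists and is finite. Let $\kappa=l/\mu$, $L=l+\frac{l^2}{2\mu}$. Let $\epsilon>0$, $\beta\leq\frac{1}{4d_2L}$, $\alpha\leq\min\{\frac{\beta}{32\kappa^2},\frac{1}{10d_1L}\}$, $\theta_1=\left(5d_1L+\frac{3}{2\alpha}+\frac32L+d_2L\right)d_1^2L^2\alpha^2$, $\mu_1=\frac{\sqrt{\alpha}\,\epsilon}{2\sqrt{\theta_1}}$, $\mu_2=\frac{\sqrt{\alpha}\,\epsilon}{\sqrt{3\beta}\,d_2L}$. Let $(x_t,y_t)_{t\geq0}$ be generated by the ZO-AGDA iteration described in the context from initial point $(x_0,y_0)$, and let $T(\epsilon)=\min\{t:\mathbb{E}\|\nabla\Phi(x_t)\|\leq\epsilon\}$. Then $$T(\epsilon)\leq\frac{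4[3\Phi(x_0)-f(x_0,y_0)-2\Phi^*]}{\alpha\epsilon^2}.$$
   Context: ZO-AGDA iteration: given $(x_t,y_t)$, draw $u_t$ uniformly from the unit sphere in $\mathbb{R}^{d_1}$ and $v_t$ uniformly from the unit sphere in $\mathbb{R}^{d_2}$, independently of everything else, and set $x_{t+1}=x_t-\alpha\,\frac{f(x_t+\mu_1u_t,y_t)-f(x_t,y_t)}{\mu_1/d_1}u_t$, then $y_{t+1}=y_t+\beta\,\frac{f(x_{t+1},y_t+\mu_2v_t)-f(x_{t+1},y_t)}{\mu_2/d_2}v_t$. Expectations are over all random vectors drawn by the algorithm. An $\epsilon$-stationary point is $\hat x$ with $\mathbb{E}\|\nabla\Phi(\hat x)\|\leq\epsilon$. *)

(* Defs.v *)
From HB Require Import structures.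
From mathcomp Require Import all_boot all_order all_algebra.
From mathcomp Require Import all_classical all_reals all_analysis.
Set Implicit Arguments. Unset Strict Implicit. Unset Printing Implicit Defensive.
Import Order.TTheory GRing.Theory Num.Theory.
Import numFieldNormedType.Exports.
Local Open Scope ring_scope.

Section Defs.
Variable R : realType.

Definition enorm (d : nat) (v : 'rV[R]_d) : R := Num.sqrt (\sum_i (v 0 i) ^+ 2).

Definition grad (d : nat) (g : 'rV[R]_d -> R) (x : 'rV[R]_d) : 'rV[R]_d :=
  \row_i ('D_(delta_mx 0 i) g x).

Fixpoint iint (n : nat) (h : seq R -> \bar R) : \bar R :=
  match n with
  | 0 => h [::]
  | n'.+1 => (\int[@lebesgue_measure R]_r iint n' (fun s => h (r :: s)))%E
  end.

Definition vec_of_seq (d : nat) (s : seq R) : 'rV[R]_d := \row_i nth 0 s i.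

(** Lebesgue integral on R^d (nonnegative integrands), as iterated integrals. *)
Definition leb_int (d : nat) (h : 'rV[R]_d -> \bar R) : \bar R :=
  iint d (fun s => h (vec_of_seq d s)).

Definition ball_ind (d : nat) (z : 'rV[R]_d) : bool := (enorm z <= 1) && (z != 0).

(** Expectation of a nonnegative h(u) for u uniformly distributed on the unit
    sphere of R^d: the uniform (normalized surface) measure on the sphere is the
    push-forward of the normalized Lebesgue measure on the unit ball under
    z |-> z / |z| (cone construction). *)
Definition sphere_expect (d : nat) (h : 'rV[R]_d -> \bar R) : \bar R :=
  (leb_int (fun z => if ball_ind z then h ((enorm z)^-1 *: z) else 0%E)
   * ((fine (leb_int (fun z : 'rV[R]_d => if ball_ind z then 1%E else 0%E)))^-1)%:E)%E.

Definition upd (T : Type) (s : nat -> T) (t : nat) (a : T) : nat -> T :=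
  fun k => if k == t then a else s k.

(** Expectation over the independent directions u_0, v_0, ..., u_{t-1}, v_{t-1}
    (u_k uniform on the unit sphere of R^d1, v_k uniform on that of R^d2) of a
    nonnegative quantity g depending on the first t directions. *)
Fixpoint expect_dirs (d1 d2 : nat) (t : nat)
  (g : (nat -> 'rV[R]_d1) -> (nat -> 'rV[R]_d2) -> \bar R) : \bar R :=
  match t with
  | 0 => g (fun _ => 0) (fun _ => 0)
  | t'.+1 => expect_dirs t' (fun us vs =>
      sphere_expect (fun u => sphere_expect (fun v =>
        g (upd us t' u) (upd vs t' v))))
  end.

Fixpoint zo_agda (d1 d2 : nat) (f : 'rV[R]_d1 -> 'rV[R]_d2 -> R)
  (alpha beta mu1 mu2 : R) (x0 : 'rV[R]_d1) (y0 : 'rV[R]_d2)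
  (us : nat -> 'rV[R]_d1) (vs : nat -> 'rV[R]_d2) (t : nat)
  : 'rV[R]_d1 * 'rV[R]_d2 :=
  match t with
  | 0 => (x0, y0)
  | t'.+1 =>
    let p := zo_agda f alpha beta mu1 mu2 x0 y0 us vs t' in
    let x := p.1 in let y := p.2 in
    let x' := x - (alpha * ((f (x + mu1 *: us t') y - f x y) / (mu1 / d1%:R)))
                    *: us t' in
    let y' := y + (beta * ((f x' (y + mu2 *: vs t') - f x' y) / (mu2 / d2%:R)))
                    *: vs t' in
    (x', y')
  end.

End Defs.

(* Main.v *)
(** The statement follows from the decay in expectation of
    V(x,y) = 2 (Phi x - Phistar) + (Phi x - f(x,y)), whose value at (x_0,y_0) is the
    bracket in the bound.
    The PL inequality at a maximizer y of f(x,.) gives Phi the upper smoothness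
    constant C = l + l^2/mu <= 2L and grad Phi (x) = grad_x f(x,y).  Applied to the
    nonnegative function Phi - f(.,y), which is (C + l)-smooth from above, this
    yields |grad_x f - grad Phi|^2 <= 4 L (Phi - f), so the gap Phi - f controls the
    error of the descent direction, while one ascent step contracts the gap by
    1 - beta mu.  Since E[<q,u>^2] = |q|^2/d on the unit sphere, one iteration gives
    E V' <= V - (7/10) alpha |grad Phi|^2 + (9/20) alpha eps^2.
    As |grad Phi|^2 >= 2 eps |grad Phi| - eps^2, after division by (7/5) alpha eps the
    expected value of V decreases by at least (5/28) eps as long as
    E|grad Phi(x_t)| > eps.
    The expectations are iterated integrals of functions of f, which are never shown
    to be measurable: monotonicity, superadditivity, and subadditivity with respect
    to measurable summands hold for all nonnegative functions.  Measurability is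
    only used for the quadratic majorants. *)
Require Import Defs.
From HB Require Import structures.
From mathcomp Require Import all_boot all_order all_algebra.
From mathcomp Require Import all_classical all_reals all_analysis.
From mathcomp Require Import perm measurable_realfun ring lra.
Set Implicit Arguments.
Unset Strict Implicit.
Unset Printing Implicit Defensive.
Import Order.TTheory GRing.Theory Num.Theory.
Import numFieldNormedType.Exports.
Local Open Scope ring_scope.

(** * Additivity of integrals of nonnegative, possibly non-measurable functions *)

Section LowerIntegral.
Local Open Scope ereal_scope.
Context {dT : measure_display} {T : measurableType dT} {R : realType}.
Variable mu : {measure set T -> \bar R}.

(* No measurability is assumed: the integral of a nonnegative function is
   defined as a supremum over the simple functions below it. *)
Lemma ge0_le_integral_nomeas (f g : T -> \bar R) :
  (forall x, 0 <= f x) -> (forall x, f x <= g x) ->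
  \int[mu]_x f x <= \int[mu]_x g x.
Proof.
move=> f0 fg; rewrite !ge0_integralTE//; last by move=> x; exact: le_trans (fg x).
apply: ereal_sup_le => _ [h /= hf <-]; exists h => // x.
exact: le_trans (hf x) (fg x).
Qed.

Import HBNNSimple.

(** Upper bounds may be tested on the simple functions below [f]; these are measurable, so the usual
    additivity theorems apply to them. *)
Lemma ge0_integral_approx (f : T -> \bar R) (c : \bar R) :
  (forall x, 0 <= f x) ->
  (forall h : {nnsfun T >-> R}, (forall x, (h x)%:E <= f x) -> \int[mu]_x (h x)%:E <= c) ->
  \int[mu]_x f x <= c.
Proof.
move=> f0 H; rewrite ge0_integralTE//; apply: ge_ereal_sup => _ [h /= hf <-].
have := H h hf; rewrite integral_nnsfun// (_ : h \_ setT = h)//.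
by apply/funext => x; rewrite patchE in_setT.
Qed.

(** For a simple [h] below [f + g], the positive part [k] of [h - g] is measurable because [g] is,
    lies below [f], and satisfies [h <= k + g]. *)
Lemma ge0_le_integralD_nomeas (f g : T -> \bar R) :
  (forall x, 0 <= f x) -> (forall x, 0 <= g x) -> measurable_fun [set: T] g ->
  \int[mu]_x (f x + g x) <= \int[mu]_x f x + \int[mu]_x g x.
Proof.
move=> f0 g0 mg; apply: ge0_integral_approx; first by move=> x; exact: adde_ge0.
move=> h hfg.
pose k x := maxe ((h x)%:E - g x) 0.
have k0 x : 0 <= k x by rewrite /k le_max lexx orbT.
have mh : measurable_fun [set: T] (EFin \o h) by exact/measurable_EFinP.
have mk : measurable_fun [set: T] k.
  by apply: measurable_maxe => //; exact: emeasurable_funB.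
apply: (@le_trans _ _ (\int[mu]_x (k x + g x))).
  apply: ge0_le_integral_nomeas => x; first by rewrite lee_fin fun_ge0.
  rewrite /k; have := g0 x; case: (g x) => [r| |] //= r0.
    rewrite -EFinB -EFin_max -EFinD lee_fin.
    have : ((h x - r <= Num.max (h x - r) 0)%R) by rewrite le_max lexx.
    by rewrite lerBlDr.
  by rewrite addeNy maxNye add0e leey.
rewrite ge0_integralD//; apply: leeD => //; apply: ge0_le_integral_nomeas => // x.
rewrite /k ge_max f0 andbT.
have := hfg x; have := g0 x; have := f0 x.
case: (g x) => [r| |] //=; case: (f x) => [s| |] //= _ _; rewrite ?leey//.
  by rewrite -EFinB !lee_fin lerBlDr.
by rewrite addeNy leNye.
Qed.

(** Simple functions below [f] and below [g] add up to one below [f + g]. The suprema are taken one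
    after the other, and the infinite cases are split off because only a finite term can be moved
    across the inequality. *)
Lemma ge0_integralD_ge_nomeas (f g : T -> \bar R) :
  (forall x, 0 <= f x) -> (forall x, 0 <= g x) ->
  \int[mu]_x f x + \int[mu]_x g x <= \int[mu]_x (f x + g x).
Proof.
move=> f0 g0.
have fg0 x : 0 <= f x + g x by exact: adde_ge0.
have H (h : {nnsfun T >-> R}) : (forall x, (h x)%:E <= g x) ->
    \int[mu]_x f x + \int[mu]_x (h x)%:E <= \int[mu]_x (f x + g x).
  move=> hg.
  have mh : measurable_fun [set: T] (EFin \o h) by exact/measurable_EFinP.
  have h0 x : 0 <= (h x)%:E by rewrite lee_fin fun_ge0.
  have [->|fin] := eqVneq (\int[mu]_x (f x + g x)) +oo; first by rewrite leey.
  have hfin : \int[mu]_x (h x)%:E \is a fin_num.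
    rewrite ge0_fin_numE ?integral_ge0//; apply: le_lt_trans (_ : _ < +oo).
      apply: (@ge0_le_integral_nomeas (EFin \o h) (fun x => f x + g x)) => //= x.
      by apply: le_trans (hg x) _; rewrite leeDr.
    by rewrite ltey.
  rewrite -leeBrDr//; apply: ge0_integral_approx => // k kf.
  rewrite leeBrDr// -ge0_integralD//; last 2 first.
    - by move=> x _; rewrite lee_fin fun_ge0.
    - exact/measurable_EFinP.
  apply: ge0_le_integral_nomeas => x; first by rewrite -EFinD lee_fin addr_ge0 ?fun_ge0.
  exact: leeD.
have [Ioo|If] := eqVneq (\int[mu]_x f x) +oo.
  apply: le_trans (leey _) _; rewrite -Ioo.
  by apply: ge0_le_integral_nomeas => // x; rewrite leeDl.
have ffin : \int[mu]_x f x \is a fin_num by rewrite ge0_fin_numE ?integral_ge0// ltey.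
rewrite addeC -leeBrDr//; apply: ge0_integral_approx => // h hg.
by rewrite leeBrDr// addeC; exact: H.
Qed.

End LowerIntegral.

(** * Iterated integrals: measurability, linearity, invariance under sign flips and swaps *)

Section IteratedIntegral.
Context {R : realType}.
Local Open Scope ereal_scope.
Implicit Types (n : nat) (h g : seq R -> \bar R).
Local Notation leb := (@lebesgue_measure R).

(* Joint measurability of [h] on sequences of size [n], tested along arbitrary
   measurable families instead of a sigma-algebra on [seq R]. *)
Definition seq_measurable (n : nat) (h : seq R -> \bar R) : Prop :=
  forall (dT : measure_display) (T : measurableType dT) (rs : seq (T -> R)),
    size rs = n -> (forall r, List.In r rs -> measurable_fun [set: T] r) ->
    measurable_fun [set: T] (fun t => h [seq r t | r <- rs]).

Lemma iint_ge0 n h : (forall s, 0 <= h s) -> 0 <= iint n h.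
Proof.
elim: n h => [|n IH] h h0 //=.
by apply: integral_ge0 => r _; exact: IH.
Qed.

Lemma iint_le n h g : (forall s, 0 <= h s) ->
  (forall s, size s = n -> h s <= g s) -> iint n h <= iint n g.
Proof.
elim: n h g => [|n IH] h g h0 hg /=; first exact: hg.
apply: ge0_le_integral_nomeas => r; first exact: iint_ge0.
by apply: IH => // s ss; apply: hg; rewrite /= ss.
Qed.

Lemma eq_iint n h g : (forall s, size s = n -> h s = g s) -> iint n h = iint n g.
Proof.
elim: n h g => [|n IH] h g hg /=; first exact: hg.
congr (integral _ _ _); apply/funext => r.
by apply: IH => s ss; apply: hg; rewrite /= ss.
Qed.

(** Induction on [n]: the outermost variable of integration joins the test family as the second
    projection of [T * R], and Tonelli integrates it out. *)
Lemma seq_measurable_iint n m h : (forall s, 0 <= h s) ->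
  seq_measurable (m + n) h ->
  seq_measurable m (fun s => iint n (fun s' => h (s ++ s'))).
Proof.
elim: n m h => [|n IH] m h h0 mh dT T rs srs mrs /=.
  have := mh dT T rs _ mrs; rewrite addn0 => /(_ srs).
  by apply: eq_measurable_fun => t _; rewrite cats0.
have K : seq_measurable m.+1 (fun s => iint n (fun s' => h (s ++ s'))).
  by apply: IH => //; rewrite addSnnS.
pose rs' : seq (T * R -> R) := rcons [seq (fun p : T * R => r p.1) | r <- rs] snd.
have srs' : size rs' = m.+1 by rewrite size_rcons size_map srs.
have mrs' r : List.In r rs' -> measurable_fun [set: (T * R)%type] r.
  have : forall q, List.In q [seq (fun p : T * R => r p.1) | r <- rs] ->
     measurable_fun [set: (T * R)%type] q.
    elim: rs mrs {srs rs' srs'} => [|a l IHl] mrs q //= [<-|].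
      by apply: measurableT_comp => //; apply: mrs; left.
    by apply: IHl => q' q'l; apply: mrs; right.
  rewrite /rs'; elim: [seq _ | _ <- _] => [|a l IHl] Hl /=.
    by case => // <-.
  case => [<-|]; first by apply: Hl; left.
  by apply: IHl => q ql; apply: Hl; right.
have := K _ _ rs' srs' mrs'.
move=> /(measurable_fun_fubini_tonelli_F (m2 := leb)) H.
apply: eq_measurable_fun (H _).
  move=> t _; rewrite /fubini_F; congr (integral _ _ _).
  apply/funext => r; congr iint; apply/funext => s'.
  rewrite /rs' map_rcons cat_rcons -map_comp.
  by congr (h (_ ++ _)); apply: eq_map.
by move=> x; exact: iint_ge0.
Qed.

Lemma seq_measurable_iint1 n h : (forall s, 0 <= h s) ->
  seq_measurable n.+1 h ->
  measurable_fun [set: R] (fun r => iint n (fun s => h (r :: s))).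
Proof.
move=> h0 mh; have H := @seq_measurable_iint n 1 h h0 mh.
have := H _ R [:: idfun] erefl; apply => r /= [<-|//]; exact: measurable_id.
Qed.

Lemma seq_measurable_cons n h r :
  seq_measurable n.+1 h -> seq_measurable n (fun s => h (r :: s)).
Proof.
move=> mh dT T rs srs mrs; have := mh dT T (cst r :: rs); apply; first by rewrite /= srs.
by move=> q /= [<-|/mrs//].
Qed.

Lemma iintD_le n h g : (forall s, 0 <= h s) -> (forall s, 0 <= g s) ->
  seq_measurable n g ->
  iint n (fun s => h s + g s) <= iint n h + iint n g.
Proof.
elim: n h g => [|n IH] h g h0 g0 mg //=.
apply: (@le_trans _ _ (\int[leb]_r (iint n (fun s => h (r :: s)) +
                                    iint n (fun s => g (r :: s))))).
  apply: ge0_le_integral_nomeas => r.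
    by apply: iint_ge0 => s; exact: adde_ge0.
  by apply: IH => //; exact: seq_measurable_cons.
apply: ge0_le_integralD_nomeas; try by move=> r; exact: iint_ge0.
exact: seq_measurable_iint1.
Qed.

Lemma iintD_ge n h g : (forall s, 0 <= h s) -> (forall s, 0 <= g s) ->
  iint n h + iint n g <= iint n (fun s => h s + g s).
Proof.
elim: n h g => [|n IH] h g h0 g0 //=.
apply: le_trans; first by apply: ge0_integralD_ge_nomeas => r; exact: iint_ge0.
apply: ge0_le_integral_nomeas => r; first by rewrite adde_ge0 ?iint_ge0.
exact: IH.
Qed.

Lemma iintD n h g : (forall s, 0 <= h s) -> (forall s, 0 <= g s) ->
  seq_measurable n g ->
  iint n (fun s => h s + g s) = iint n h + iint n g.
Proof.
by move=> h0 g0 mg; apply/eqP; rewrite eq_le iintD_le//= iintD_ge.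
Qed.

Lemma iintZ n (k : R) g : (0 <= k)%R -> (forall s, 0 <= g s) ->
  seq_measurable n g ->
  iint n (fun s => k%:E * g s) = k%:E * iint n g.
Proof.
move=> k0; elim: n g => [|n IH] g g0 mg //=.
rewrite -ge0_integralZl_EFin//; last 2 first.
- by move=> r _; exact: iint_ge0.
- exact: seq_measurable_iint1.
congr (integral _ _ _); apply/funext => r.
by apply: IH => //; exact: seq_measurable_cons.
Qed.

Fixpoint flip_seq (k : nat) (s : seq R) : seq R :=
  match k, s with
  | 0%N, r :: s' => (- r)%R :: s'
  | k'.+1, r :: s' => r :: flip_seq k' s'
  | _, [::] => [::]
  end.

Fixpoint swap_seq (k : nat) (s : seq R) : seq R :=
  match k, s with
  | 0%N, r :: r' :: s' => r' :: r :: s'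
  | k'.+1, r :: s' => r :: swap_seq k' s'
  | _, _ => s
  end.

Lemma nth_flip_seq k s i : (k < size s)%N ->
  nth 0%R (flip_seq k s) i = (if i == k then - nth 0%R s i else nth 0%R s i)%R.
Proof.
elim: k s i => [|k IH] [|r s] [|i] //= ks; exact: IH.
Qed.

Lemma nth_swap_seq k s i : (k.+1 < size s)%N ->
  nth 0%R (swap_seq k s) i =
    nth 0%R s (if i == k then k.+1 else if i == k.+1 then k else i).
Proof.
elim: k s i => [|k IH] [|r [|r' s]] [|i] //= ks; first by case: i.
by rewrite IH//= !eqSS; case: eqP => //; case: eqP.
Qed.

Lemma ge0_integralN (f : R -> \bar R) : measurable_fun [set: R] f ->
  (forall r, 0 <= f r) -> \int[leb]_r f (- r)%R = \int[leb]_r f r.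
Proof.
move=> mf f0.
have := @ge0_integral_pushforward _ _ (measurableTypeR R) (measurableTypeR R) R (-%R : R -> measurableTypeR R)
  (@oppr_measurable R setT) leb setT f measurableT mf.
rewrite preimage_setT => <-; last by move=> r _; exact: f0.
by apply: eq_measure_integral => A mA _; exact: lebesgue_measureN.
Qed.

Lemma iint_flip n k h : (k < n)%N -> (forall s, 0 <= h s) -> seq_measurable n h ->
  iint n (fun s => h (flip_seq k s)) = iint n h.
Proof.
elim: k n h => [|k IH] [|n] h //= kn h0 mh.
  apply: (@ge0_integralN (fun r => iint n (fun s => h (r :: s)))).
    exact: seq_measurable_iint1.
  by move=> r; exact: iint_ge0.
congr (integral _ _ _); apply/funext => r.
by apply: IH => //; exact: seq_measurable_cons.
Qed.

(** Positions are adjacent, so the base case is the exchange of the two outermost integrals by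
    Tonelli, and deeper positions reduce to it under the outer integrals. *)
Lemma iint_swap n k h : (k.+1 < n)%N -> (forall s, 0 <= h s) -> seq_measurable n h ->
  iint n (fun s => h (swap_seq k s)) = iint n h.
Proof.
elim: k n h => [|k IH] [|[|n]] h //= kn h0 mh.
  pose f (p : R * R) := iint n (fun s => h (p.1 :: p.2 :: s)).
  have mf : measurable_fun [set: (R * R)%type] f.
    have H := @seq_measurable_iint n 2 h h0 mh.
    have := H _ _ [:: (fst : R * R -> R); snd] erefl; apply.
    by move=> r /= [<-|[<-|//]].
  have f0 p : 0 <= f p by exact: iint_ge0.
  exact: (esym (fubini_tonelli (m1 := leb) (m2 := leb) f mf f0)).
congr (integral _ _ _); apply/funext => r.
by apply: (IH n.+1 (fun s => h (r :: s))) => //; exact: seq_measurable_cons.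
Qed.

End IteratedIntegral.

(** * Euclidean norm and inner product *)

Section Euclid.
Context {R : realType}.
Variable d : nat.
Implicit Types (u v p q z : 'rV[R]_d).

Definition dotv u v : R := \sum_i u 0 i * v 0 i.

Lemma enorm_ge0 v : 0 <= enorm v. Proof. exact: sqrtr_ge0. Qed.

Lemma sum_sqr_ge0 v : 0 <= \sum_i (v 0 i) ^+ 2.
Proof. by apply: sumr_ge0 => i _; exact: sqr_ge0. Qed.

Lemma sqr_enorm v : enorm v ^+ 2 = \sum_i (v 0 i) ^+ 2.
Proof. by rewrite sqr_sqrtr// sum_sqr_ge0. Qed.

Lemma dotvv v : dotv v v = enorm v ^+ 2.
Proof. by rewrite sqr_enorm; apply: eq_bigr => i _; rewrite expr2. Qed.

Lemma enorm_eq0 v : (enorm v == 0) = (v == 0).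
Proof.
apply/idP/eqP => [/eqP n0|->].
  have : \sum_i (v 0 i) ^+ 2 = 0 by rewrite -sqr_enorm n0 expr0n.
  move=> /psumr_eq0P H; apply/rowP => i; rewrite mxE.
  by apply/eqP; rewrite -sqrf_eq0; apply/eqP/H => // j _; exact: sqr_ge0.
by rewrite -sqrf_eq0 sqr_enorm big1// => i _; rewrite mxE expr0n.
Qed.

Lemma enormZ (a : R) v : enorm (a *: v) = `|a| * enorm v.
Proof.
rewrite /enorm -(sqrtr_sqr a) -sqrtrM ?sqr_ge0//; congr Num.sqrt.
by rewrite mulr_sumr; apply: eq_bigr => i _; rewrite mxE exprMn.
Qed.

Lemma dotvC u v : dotv u v = dotv v u.
Proof. by apply: eq_bigr => i _; rewrite mulrC. Qed.

Lemma dotvDl u v w : dotv (u + v) w = dotv u w + dotv v w.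
Proof. by rewrite -big_split; apply: eq_bigr => i _; rewrite mxE mulrDl. Qed.

Lemma dotvZl (a : R) u v : dotv (a *: u) v = a * dotv u v.
Proof. by rewrite mulr_sumr; apply: eq_bigr => i _; rewrite mxE mulrA. Qed.

Lemma dotvZr (a : R) u v : dotv u (a *: v) = a * dotv u v.
Proof. by rewrite dotvC dotvZl dotvC. Qed.

Lemma dotvNl u v : dotv (- u) v = - dotv u v.
Proof. by rewrite -scaleN1r dotvZl mulN1r. Qed.

Lemma dotvBl u v w : dotv (u - v) w = dotv u w - dotv v w.
Proof. by rewrite dotvDl dotvNl. Qed.

(** The squared norm of [|v| u - |u| v] equals [2 |u| |v| (|u| |v| - <u,v>)]. The factor [|u| |v|]
    can be cancelled once zero vectors are treated apart. *)
Lemma cauchy_schwarz u v : dotv u v <= enorm u * enorm v.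
Proof.
have [v0|vn0] := eqVneq v 0.
  have -> : enorm v = 0 by apply/eqP; rewrite enorm_eq0 v0.
  by rewrite mulr0 v0 /dotv big1// => i _; rewrite mxE mulr0.
have v0 : 0 < enorm v by rewrite lt_def enorm_ge0 enorm_eq0 vn0.
have : 0 <= enorm (enorm v *: u - enorm u *: v) ^+ 2 by exact: sqr_ge0.
rewrite -dotvv dotvBl !dotvZl !(dotvC _ (_ - _)) !dotvBl !dotvZl !dotvv (dotvC v u) => H.
have {}H : 0 <= (enorm u * enorm v) * (enorm u * enorm v - dotv u v).
  suff -> : enorm u * enorm v * (enorm u * enorm v - dotv u v) =
    (enorm v * (enorm v * enorm u ^+ 2 - enorm u * dotv u v) -
     enorm u * (enorm v * dotv u v - enorm u * enorm v ^+ 2)) / 2.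
    by rewrite divr_ge0.
  by field.
have [u0|un0] := eqVneq u 0.
  have -> : enorm u = 0 by apply/eqP; rewrite enorm_eq0 u0.
  by rewrite mul0r u0 /dotv big1// => i _; rewrite mxE mul0r.
have u0 : 0 < enorm u by rewrite lt_def enorm_ge0 enorm_eq0 un0.
by move: H; rewrite pmulr_rge0 ?mulr_gt0// subr_ge0.
Qed.

Lemma enorm_normalize z : z != 0 -> enorm ((enorm z)^-1 *: z) = 1.
Proof.
move=> z0; rewrite enormZ ger0_norm ?invr_ge0 ?enorm_ge0//.
by rewrite mulVf// enorm_eq0.
Qed.

Lemma ball_indE z : ball_ind z = (enorm z <= 1) && (enorm z != 0).
Proof. by rewrite /ball_ind enorm_eq0. Qed.

End Euclid.

(** * Integration over the sphere through radial projection of the ball *)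

Section SphereIntegral.
Context {R : realType}.
Variable d : nat.
Implicit Types (u v p q z : 'rV[R]_d) (phi psi : 'rV[R]_d -> R).
Implicit Types (h g : 'rV[R]_d -> \bar R).

(** The unnormalized [sphere_expect]; its value at the constant 1 is the volume of the unit ball. *)
Definition sphere_int h : \bar R :=
  leb_int (fun z => if ball_ind z then h ((enorm z)^-1 *: z) else 0%E).

Lemma sphere_expectE h : sphere_expect h =
  (sphere_int h * ((fine (sphere_int (fun=> 1%E)))^-1)%:E)%E.
Proof. by []. Qed.

(** Measurability after radial projection, tested along families of coordinate functions so that it
    matches [seq_measurable] for [on_ball]. *)
Definition sphere_measurable phi : Prop :=
  forall (dT : measure_display) (T : measurableType dT) (z : 'I_d -> T -> R),
    (forall i, measurable_fun [set: T] (z i)) ->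
    measurable_fun [set: T]
      (fun t => phi ((enorm (\row_i z i t))^-1 *: \row_i z i t)).

Lemma sphere_measurable_cst (c : R) : sphere_measurable (fun=> c).
Proof. by move=> dT T z mz; exact: measurable_cst. Qed.

Lemma sphere_measurableD phi psi : sphere_measurable phi ->
  sphere_measurable psi -> sphere_measurable (fun u => phi u + psi u).
Proof. by move=> a b dT T z mz; apply: measurable_funD; [exact: a|exact: b]. Qed.

Lemma sphere_measurableM phi psi : sphere_measurable phi ->
  sphere_measurable psi -> sphere_measurable (fun u => phi u * psi u).
Proof. by move=> a b dT T z mz; apply: measurable_funM; [exact: a|exact: b]. Qed.

Lemma sphere_measurableX phi n : sphere_measurable phi ->
  sphere_measurable (fun u => phi u ^+ n).
Proof. by move=> a dT T z mz; apply: measurable_funX; exact: a. Qed.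

Lemma sphere_measurable_sum I (r : seq I) (P : pred I) (phi : I -> 'rV[R]_d -> R) :
  (forall i, sphere_measurable (phi i)) ->
  sphere_measurable (fun u => \sum_(i <- r | P i) phi i u).
Proof.
move=> H; elim: r => [|i r IH].
  by move=> dT T z mz; under eq_fun do rewrite big_nil; exact: measurable_cst.
move=> dT T z mz; under eq_fun do rewrite big_cons.
case: (P i); last exact: IH.
by apply: measurable_funD; [exact: H|exact: IH].
Qed.

Lemma measurable_sum_sqr dT (T : measurableType dT) (z : 'I_d -> T -> R) :
  (forall i, measurable_fun [set: T] (z i)) ->
  measurable_fun [set: T] (fun t => \sum_i ((\row_i z i t : 'rV_d) 0 i) ^+ 2).
Proof.
move=> mz; apply: measurable_sum => i.
by under eq_fun do rewrite mxE; exact: measurable_funX.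
Qed.

Lemma sphere_measurable_coord i : sphere_measurable (fun u => u 0 i).
Proof.
move=> dT T z mz; under eq_fun do rewrite !mxE.
apply: measurable_funM; last exact: mz.
(* The inverse norm is the power -1/2 of the sum of squares, also at the origin, where both are 0 by
   convention. *)
have : measurable_fun [set: T]
    (fun t => (\sum_i ((\row_i z i t : 'rV_d) 0 i) ^+ 2) `^ (- 2^-1)).
  exact: (measurableT_comp (measurable_powR (- 2^-1)) (measurable_sum_sqr mz)).
by apply: eq_measurable_fun => t _; rewrite powRN powR12_sqrt// sum_sqr_ge0.
Qed.

Lemma sphere_measurable_dotv p : sphere_measurable (fun u => dotv p u).
Proof.
apply: sphere_measurable_sum => i; apply: sphere_measurableM.
  exact: sphere_measurable_cst.
exact: sphere_measurable_coord.
Qed.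

Definition on_ball h (s : seq R) : \bar R :=
  let z := vec_of_seq d s in if ball_ind z then h ((enorm z)^-1 *: z) else 0%E.

Lemma sphere_intE h : sphere_int h = iint d (on_ball h).
Proof. by []. Qed.

Lemma on_ball_ge0 h : (forall u, enorm u = 1 -> (0 <= h u)%E) ->
  forall s, (0 <= on_ball h s)%E.
Proof.
move=> h0 s; rewrite /on_ball; case: ifPn => // /andP[_ z0].
exact/h0/enorm_normalize.
Qed.

Lemma on_ball_measurable phi : sphere_measurable phi ->
  seq_measurable d (on_ball (fun u => (phi u)%:E)).
Proof.
move=> mphi dT T rs srs mrs.
pose z (i : 'I_d) := nth (fun=> 0) rs i.
have mz i : measurable_fun [set: T] (z i).
  apply: mrs; rewrite {}/z.
  have : (i < size rs)%N by rewrite srs.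
  elim: rs (nat_of_ord i) {srs} => [|a l IH] [|k] //= kl; first by left.
  by right; exact: IH.
have E t : vec_of_seq d [seq r t | r <- rs] = \row_i z i t.
  apply/rowP => i; rewrite !mxE (nth_map (fun=> 0)) ?srs//.
rewrite /on_ball; under eq_fun do rewrite E.
apply: measurable_fun_ifT; last exact: measurable_cst.
  have H t : ball_ind (\row_i z i t : 'rV[R]_d) =
    (\sum_i ((\row_i z i t : 'rV_d) 0 i) ^+ 2 <= 1) &&
     ~~ (\sum_i ((\row_i z i t : 'rV_d) 0 i) ^+ 2 == 0).
    rewrite ball_indE -sqr_enorm expf_eq0/=.
    by rewrite -[X in _ = (_ <= X) && _](expr1n R 2) ler_pXn2r// ?nnegrE// enorm_ge0.
  under eq_fun do rewrite H.
  apply: measurable_and.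
    by apply: measurable_fun_ler; [exact: measurable_sum_sqr|exact: measurable_cst].
  apply: measurable_neg.
  by apply: measurable_fun_eqr; [exact: measurable_sum_sqr|exact: measurable_cst].
by apply/measurable_EFinP; exact: mphi.
Qed.

Lemma sphere_int_ge0 h : (forall u, enorm u = 1 -> (0 <= h u)%E) ->
  (0 <= sphere_int h)%E.
Proof. by move=> h0; apply: iint_ge0; exact: on_ball_ge0. Qed.

Lemma sphere_int_le h g : (forall u, enorm u = 1 -> (0 <= h u)%E) ->
  (forall u, enorm u = 1 -> (h u <= g u)%E) -> (sphere_int h <= sphere_int g)%E.
Proof.
move=> h0 hg; apply: iint_le => [s|s _]; first exact: on_ball_ge0.
rewrite /on_ball; case: ifPn => // /andP[_ z0].
exact/hg/enorm_normalize.
Qed.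

Lemma eq_sphere_int h g : (forall u, enorm u = 1 -> h u = g u) ->
  sphere_int h = sphere_int g.
Proof.
move=> hg; apply: eq_iint => s _.
case: ifPn => // /andP[_ z0]; exact/hg/enorm_normalize.
Qed.

Lemma on_ballD h g s :
  on_ball (fun u => h u + g u)%E s = (on_ball h s + on_ball g s)%E.
Proof. by rewrite /on_ball; case: ifP => // _; rewrite adde0. Qed.

Lemma sphere_intD_ge h g : (forall u, enorm u = 1 -> (0 <= h u)%E) ->
  (forall u, enorm u = 1 -> (0 <= g u)%E) ->
  (sphere_int h + sphere_int g <= sphere_int (fun u => h u + g u))%E.
Proof.
move=> h0 g0; rewrite !sphere_intE.
rewrite (eq_iint (fun s _ => on_ballD h g s)).
by apply: iintD_ge; exact: on_ball_ge0.
Qed.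

Lemma sphere_intD h phi : (forall u, enorm u = 1 -> (0 <= h u)%E) ->
  (forall u, enorm u = 1 -> 0 <= phi u) -> sphere_measurable phi ->
  (sphere_int (fun u => h u + (phi u)%:E) =
   sphere_int h + sphere_int (fun u => (phi u)%:E))%E.
Proof.
move=> h0 g0 mphi; rewrite !sphere_intE.
rewrite (eq_iint (fun s _ => on_ballD h (fun u => (phi u)%:E) s)).
by apply: iintD; [exact: on_ball_ge0|exact: on_ball_ge0|exact: on_ball_measurable].
Qed.

Lemma sphere_intD_EFin phi psi : (forall u, enorm u = 1 -> 0 <= phi u) ->
  (forall u, enorm u = 1 -> 0 <= psi u) -> sphere_measurable psi ->
  sphere_int (fun u => (phi u + psi u)%:E) =
  (sphere_int (fun u => (phi u)%:E) + sphere_int (fun u => (psi u)%:E))%E.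
Proof. by move=> phi0 psi0 mpsi; rewrite -sphere_intD. Qed.

Lemma sphere_intZ (k : R) phi : 0 <= k ->
  (forall u, enorm u = 1 -> 0 <= phi u) -> sphere_measurable phi ->
  (sphere_int (fun u => (k * phi u)%:E) =
   k%:E * sphere_int (fun u => (phi u)%:E))%E.
Proof.
move=> k0 g0 mphi; rewrite !sphere_intE -iintZ//.
- by apply: eq_iint => s _; rewrite /on_ball; case: ifP => // _; rewrite mule0.
- exact: on_ball_ge0.
- exact: on_ball_measurable.
Qed.

(** [tau] preserves the ball and commutes with radial projection, so invariance of the iterated
    integral under [sigma] passes to the sphere. *)
Lemma sphere_int_isometry (tau : 'rV[R]_d -> 'rV[R]_d) (sigma : seq R -> seq R) phi :
  (forall s, size s = d -> vec_of_seq d (sigma s) = tau (vec_of_seq d s)) ->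
  (forall h : seq R -> \bar R, (forall s, (0 <= h s)%E) -> seq_measurable d h ->
     iint d (fun s => h (sigma s)) = iint d h) ->
  (forall z, enorm (tau z) = enorm z) ->
  (forall (a : R) z, tau (a *: z) = a *: tau z) ->
  (forall u, enorm u = 1 -> 0 <= phi u) -> sphere_measurable phi ->
  sphere_int (fun u => (phi (tau u))%:E) = sphere_int (fun u => (phi u)%:E).
Proof.
move=> st si tn tZ phi0 mphi.
rewrite [RHS]sphere_intE -si; last 2 first.
- exact: on_ball_ge0.
- exact: on_ball_measurable.
apply: eq_iint => s sd; rewrite /on_ball st// !ball_indE tn.
by case: ifP => // _; rewrite tZ.
Qed.

(** * Coordinate symmetries and second moments on the sphere *)

Definition flipv (i : 'I_d) z : 'rV[R]_d :=
  \row_j (if j == i then - z 0 j else z 0 j).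

Lemma sphere_int_flip i phi :
  (forall u, enorm u = 1 -> 0 <= phi u) -> sphere_measurable phi ->
  sphere_int (fun u => (phi (flipv i u))%:E) = sphere_int (fun u => (phi u)%:E).
Proof.
apply: (@sphere_int_isometry _ (flip_seq i)).
- by move=> s sd; apply/rowP => j; rewrite !mxE nth_flip_seq// sd.
- by move=> h; exact: iint_flip.
- move=> z; rewrite /enorm; congr Num.sqrt; apply: eq_bigr => j _.
  by rewrite mxE; case: ifP => // _; rewrite sqrrN.
- by move=> a z; apply/rowP => j; rewrite !mxE; case: ifP => // _; rewrite mulrN.
Qed.

Lemma sphere_int_swap (i j : 'I_d) phi : j = i.+1 :> nat ->
  (forall u, enorm u = 1 -> 0 <= phi u) -> sphere_measurable phi ->
  sphere_int (fun u => (phi (\row_m u 0 (tperm i j m)))%:E) =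
  sphere_int (fun u => (phi u)%:E).
Proof.
move=> ij; apply: (@sphere_int_isometry _ (swap_seq i)).
- move=> s sd; apply/rowP => m; rewrite !mxE nth_swap_seq; last by rewrite sd -ij.
  congr nth; case: tpermP => [->|->|/eqP mi /eqP mj].
  + by rewrite eqxx ij.
  + by rewrite ij eqxx gtn_eqF.
  + by rewrite -ij; case: eqP => [/val_inj/eqP|_]; [rewrite (negbTE mi)|
      case: eqP => // /val_inj/eqP; rewrite (negbTE mj)].
- by move=> h; apply: iint_swap; rewrite -ij.
- move=> z; rewrite /enorm; congr Num.sqrt.
  rewrite [RHS](reindex_inj (@perm_inj _ (tperm i j))).
  by apply: eq_bigr => m _; rewrite mxE.
- by move=> a z; apply/rowP => m; rewrite !mxE.
Qed.

(** A chain of adjacent swaps brings each coordinate down to coordinate 0. *)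
Lemma sphere_int_coord_eq (i j : 'I_d) :
  sphere_int (fun u => (u 0 i ^+ 2)%:E) = sphere_int (fun u => (u 0 j ^+ 2)%:E).
Proof.
have mc i' : sphere_measurable (fun u => u 0 i' ^+ 2).
  exact/sphere_measurableX/sphere_measurable_coord.
have H k (hk : (k < d)%N) (h0 : (0 < d)%N) :
    sphere_int (fun u => (u 0 (Ordinal hk) ^+ 2)%:E) =
    sphere_int (fun u => (u 0 (Ordinal h0) ^+ 2)%:E).
  elim: k hk => [|k IH] hk; first by congr sphere_int; apply/funext => u; congr ((u 0 _ ^+ 2)%:E); exact: val_inj.
  rewrite -(IH (ltnW hk)) -(@sphere_int_swap (Ordinal (ltnW hk)) (Ordinal hk))//.
  - by apply: eq_sphere_int => u _; rewrite mxE tpermR.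
  - by move=> u _; exact: sqr_ge0.
have h0 : (0 < d)%N by case: (d) i => [[]|].
by case: i j => [k hk] [k' hk']; rewrite (H _ hk h0) (H _ hk' h0).
Qed.

Lemma adde_self_inj (x y : \bar R) :
  (0 <= x)%E -> (0 <= y)%E -> (x + x = y + y)%E -> x = y.
Proof.
by case: x => [x| |]; case: y => [y| |] //= _ _ [] ?; congr (_%:E); lra.
Qed.

(* The cross terms of the square are odd in some coordinate, so they integrate
   to zero. They are removed one coordinate at a time by averaging over a sign
   flip, which keeps all the integrands nonnegative. *)
Lemma sphere_int_dotv_diag p :
  sphere_int (fun u => (dotv p u ^+ 2)%:E) =
  sphere_int (fun u => (\sum_i p 0 i ^+ 2 * u 0 i ^+ 2)%:E).
Proof.
(* [psi m] is the integrand once the first [m] coordinates are diagonalized; [tl m] carries the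
   coordinates still inside the square. *)
pose tl m : 'rV[R]_d := \row_i (if (i < m)%N then 0 else p 0 i).
pose psi m u := dotv (tl m) u ^+ 2 + \sum_(i < d | (i < m)%N) p 0 i ^+ 2 * u 0 i ^+ 2.
have psi0 m u : 0 <= psi m u.
  rewrite addr_ge0 ?sqr_ge0// sumr_ge0// => i _.
  by rewrite mulr_ge0 ?sqr_ge0.
have mpsi m : sphere_measurable (psi m).
  apply: sphere_measurableD; first exact/sphere_measurableX/sphere_measurable_dotv.
  apply: sphere_measurable_sum => i; apply: sphere_measurableM.
    exact: sphere_measurable_cst.
  exact/sphere_measurableX/sphere_measurable_coord.
have step m : (m < d)%N -> sphere_int (fun u => (psi m u)%:E) =
                          sphere_int (fun u => (psi m.+1 u)%:E).
  move=> md; pose i0 := Ordinal md.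
  have I0 m' : (0 <= sphere_int (fun u => (psi m' u)%:E))%E.
    by apply: sphere_int_ge0 => u _; rewrite lee_fin.
  (* With [a] the term of coordinate [m] and [b] the remaining tail, averaging over the flip uses
     [(a + b)^2 + (b - a)^2 = 2 a^2 + 2 b^2]. *)
  apply: adde_self_inj => //.
  rewrite -[X in (X + _)%E](sphere_int_flip i0)//.
  rewrite -!sphere_intD_EFin//; apply: eq_sphere_int => u _; congr EFin.
  have tlE v : dotv (tl m) v = p 0 i0 * v 0 i0 + dotv (tl m.+1) v.
    rewrite /dotv (bigD1 i0)//= [in RHS](bigD1 i0)//= !mxE/= ltnn leqnn mul0r add0r.
    congr (_ + _); apply: eq_bigr => i ii0; rewrite !mxE ltnS.
    rewrite (leq_eqVlt i m) (_ : (i == m :> nat) = false)//.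
    by apply: contraNF ii0 => /eqP im; exact/eqP/val_inj.
  have sE v : \sum_(i < d | (i < m.+1)%N) p 0 i ^+ 2 * v 0 i ^+ 2 =
      p 0 i0 ^+ 2 * v 0 i0 ^+ 2 + \sum_(i < d | (i < m)%N) p 0 i ^+ 2 * v 0 i ^+ 2.
    rewrite (bigD1 i0)//=; congr (_ + _); apply: eq_bigl => i.
    by rewrite -(inj_eq val_inj)/= ltnS [RHS]ltn_neqAle andbC.
  have f1 : dotv (tl m.+1) (flipv i0 u) = dotv (tl m.+1) u.
    apply: eq_bigr => i _; rewrite !mxE; case: ifP => [|im]; first by rewrite !mul0r.
    by case: eqP => // ii0; move: im; rewrite ii0 /= ltnS leqnn.
  have f2 : \sum_(i < d | (i < m)%N) p 0 i ^+ 2 * flipv i0 u 0 i ^+ 2 =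
            \sum_(i < d | (i < m)%N) p 0 i ^+ 2 * u 0 i ^+ 2.
    by apply: eq_bigr => i _; rewrite mxE; case: ifP => // _; rewrite sqrrN.
  rewrite /psi !tlE !sE f1 f2 mxE eqxx; ring.
have all m : (m <= d)%N -> sphere_int (fun u => (psi 0%N u)%:E) =
                          sphere_int (fun u => (psi m u)%:E).
  by elim: m => [|m IH] md; [|rewrite (IH (ltnW md)); exact: step].
transitivity (sphere_int (fun u => (psi 0%N u)%:E)).
  apply: eq_sphere_int => u _; congr EFin; rewrite /psi big_pred0// addr0.
  by congr (_ ^+ 2); apply: eq_bigr => i _; rewrite mxE.
rewrite (all d)//; apply: eq_sphere_int => u _; congr EFin.
rewrite /psi (_ : dotv _ _ = 0) ?expr0n ?add0r; last first.
  by rewrite /dotv big1// => i _; rewrite mxE ltn_ord mul0r.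
by apply: eq_bigl => i; rewrite ltn_ord.
Qed.

Lemma sphere_int_diag (i0 : 'I_d) (c : 'I_d -> R) : (forall i, 0 <= c i) ->
  (sphere_int (fun u => (\sum_i c i * u 0 i ^+ 2)%:E) =
   (\sum_i c i)%:E * sphere_int (fun u => (u 0 i0 ^+ 2)%:E))%E.
Proof.
move=> c0.
have mc i : sphere_measurable (fun u => c i * u 0 i ^+ 2).
  apply: sphere_measurableM; first exact: sphere_measurable_cst.
  exact/sphere_measurableX/sphere_measurable_coord.
have p0 i u : 0 <= c i * u 0 i ^+ 2 by rewrite mulr_ge0 ?sqr_ge0.
elim: (index_enum _) => [|i r IH].
  rewrite big_nil mul0e.
  have -> : (fun u => (\sum_(i <- [::]) c i * u 0 i ^+ 2)%:E) =
            (fun u : 'rV[R]_d => (0 * 1)%:E).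
    by apply/funext => u; rewrite big_nil mul0r.
  rewrite (sphere_intZ (phi := fun=> 1)) ?mul0e//; exact: sphere_measurable_cst.
rewrite big_cons EFinD ge0_muleDl; last 2 first.
- by rewrite lee_fin.
- by rewrite lee_fin sumr_ge0.
rewrite -IH (sphere_int_coord_eq i0 i) -sphere_intZ//; last 2 first.
- by move=> u _; exact: sqr_ge0.
- exact/sphere_measurableX/sphere_measurable_coord.
rewrite -sphere_intD_EFin//.
- by apply: eq_sphere_int => u _; rewrite big_cons.
- by move=> u _; rewrite sumr_ge0.
- exact: sphere_measurable_sum.
Qed.

(** The squared coordinates have equal integrals and sum to 1 on the sphere. The product form in the
    extended reals does not presuppose finite integrals. *)
Lemma sphere_int_dotv p : (0 < d)%N ->
  (d%:R%:E * sphere_int (fun u => (dotv p u ^+ 2)%:E) =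
   (enorm p ^+ 2)%:E * sphere_int (fun=> 1))%E.
Proof.
move=> hd; pose i0 := Ordinal hd.
rewrite sphere_int_dotv_diag (sphere_int_diag i0)//; last by move=> i; exact: sqr_ge0.
have -> : sphere_int (fun=> 1%E) =
          (d%:R%:E * sphere_int (fun u => (u 0 i0 ^+ 2)%:E))%E.
  have -> : (d%:R : R) = \sum_(i < d) 1 by rewrite sumr_const card_ord.
  rewrite -sphere_int_diag//; apply: eq_sphere_int => u u1; congr EFin.
  by under eq_bigr do rewrite mul1r; rewrite -sqr_enorm u1 expr1n.
by rewrite -sqr_enorm muleCA.
Qed.

(** * Expectation over one random direction *)

Lemma sphere_expect_ge0 h : (forall u, enorm u = 1 -> (0 <= h u)%E) ->
  (0 <= sphere_expect h)%E.
Proof.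
move=> h0; rewrite sphere_expectE mule_ge0 ?sphere_int_ge0//.
by rewrite lee_fin invr_ge0 fine_ge0// sphere_int_ge0.
Qed.

Lemma sphere_expect_le h g : (forall u, enorm u = 1 -> (0 <= h u)%E) ->
  (forall u, enorm u = 1 -> (h u <= g u)%E) ->
  (sphere_expect h <= sphere_expect g)%E.
Proof.
move=> h0 hg; rewrite !sphere_expectE lee_wpmul2r ?sphere_int_le//.
by rewrite lee_fin invr_ge0 fine_ge0// sphere_int_ge0.
Qed.

Lemma sphere_expectD_ge h g : (forall u, enorm u = 1 -> (0 <= h u)%E) ->
  (forall u, enorm u = 1 -> (0 <= g u)%E) ->
  (sphere_expect h + sphere_expect g <= sphere_expect (fun u => h u + g u))%E.
Proof.
move=> h0 g0; rewrite !sphere_expectE -ge0_muleDl ?sphere_int_ge0//.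
rewrite lee_wpmul2r ?sphere_intD_ge//.
by rewrite lee_fin invr_ge0 fine_ge0// sphere_int_ge0.
Qed.

(** Only an inequality, since the total mass of [sphere_expect] is 1 for a finite nonzero ball
    volume and 0 otherwise. *)
Lemma sphere_expectD_cst_le h (c : R) :
  (forall u, enorm u = 1 -> (0 <= h u)%E) -> 0 <= c ->
  (sphere_expect (fun u => h u + c%:E) <= sphere_expect h + c%:E)%E.
Proof.
move=> h0 c0; rewrite !sphere_expectE.
have -> : (fun u => h u + c%:E)%E = (fun u => h u + (c * 1)%:E)%E.
  by apply/funext => u; rewrite mulr1.
rewrite sphere_intD//; last by move=> u _; rewrite mulr1.
rewrite sphere_intZ//.
have J0 : (0 <= sphere_int (fun=> 1%E))%E by exact: sphere_int_ge0.
rewrite ge0_muleDl ?sphere_int_ge0 ?mule_ge0//.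
rewrite leeD2l// -muleA -[leRHS]mule1 lee_wpmul2l//.
case: (sphere_int _) J0 => [j| |]//= j0; last by rewrite invr0 mule0.
rewrite -EFinM lee_fin; have [->|jn] := eqVneq j 0; first by rewrite mul0r.
by rewrite mulfV.
Qed.

(* When the normalizing volume is degenerate (0 or infinite), [sphere_expect]
   is 0, so no hypothesis on the volume of the ball is needed. *)
Lemma sphere_expect_quad_le h (A c k B : R) p q : (0 < d)%N ->
  (forall u, enorm u = 1 -> (0 <= h u)%E) ->
  0 <= A -> 0 <= c -> 0 <= k -> 0 <= B ->
  (forall u, enorm u = 1 ->
     (h u <= (A - c * dotv p u ^+ 2 + k * dotv q u ^+ 2)%:E)%E) ->
  A - c * (enorm p ^+ 2 / d%:R) + k * (enorm q ^+ 2 / d%:R) <= B ->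
  (sphere_expect h <= B%:E)%E.
Proof.
move=> hd h0 A0 c0 k0 B0 hX HB.
pose X u := A - c * dotv p u ^+ 2 + k * dotv q u ^+ 2.
have X0 u : enorm u = 1 -> 0 <= X u.
  by move=> u1; rewrite -lee_fin; apply: le_trans (hX u u1); exact: h0.
apply: (@le_trans _ _ (sphere_expect (fun u => (X u)%:E))).
  exact: sphere_expect_le.
rewrite sphere_expectE.
have msq v : sphere_measurable (fun u => dotv v u ^+ 2).
  exact/sphere_measurableX/sphere_measurable_dotv.
have mZ (a : R) v : sphere_measurable (fun u => a * dotv v u ^+ 2).
  by apply: sphere_measurableM => //; exact: sphere_measurable_cst.
have sq0 v u : 0 <= dotv v u ^+ 2 by exact: sqr_ge0.
(* The subtracted term is moved to the other side, so that all integrands are nonnegative and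
   additivity applies. *)
have E1 : (sphere_int (fun u => (X u)%:E) + sphere_int (fun u => (c * dotv p u ^+ 2)%:E)
   = sphere_int (fun=> (A * 1)%:E) + sphere_int (fun u => (k * dotv q u ^+ 2)%:E))%E.
  have kq0 a v u : 0 <= a -> 0 <= a * dotv v u ^+ 2.
    by move=> a0; rewrite mulr_ge0.
  rewrite -!sphere_intD_EFin//; try by move=> u _; rewrite ?mulr1 ?kq0.
  by apply: eq_sphere_int => u _; rewrite /X; congr EFin; ring.
move: E1; rewrite !sphere_intZ//.
have Ep := sphere_int_dotv p hd; have Eq := sphere_int_dotv q hd.
have J0 : (0 <= sphere_int (fun=> 1%E))%E by exact: sphere_int_ge0.
have SX0 : (0 <= sphere_int (fun u => (X u)%:E))%E.
  by apply: sphere_int_ge0 => u u1; rewrite lee_fin X0.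
have Sp0 : (0 <= sphere_int (fun u => (dotv p u ^+ 2)%:E))%E.
  by apply: sphere_int_ge0 => u _; rewrite lee_fin.
have Sq0 : (0 <= sphere_int (fun u => (dotv q u ^+ 2)%:E))%E.
  by apply: sphere_int_ge0 => u _; rewrite lee_fin.
have d0 : (0 : R) < d%:R by rewrite ltr0n.
have fin a (s : \bar R) j : (0 <= s)%E -> (d%:R%:E * s = a%:E * j%:E)%E ->
    s = (a / d%:R * j)%:E.
  case: s => [s| |]//= _; last by rewrite gt0_muley ?lte_fin.
  rewrite -!EFinM => -[e]; congr EFin; move: e => /(congr1 (fun x => x / d%:R)).
  by rewrite mulrAC mulfV ?gt_eqF// mul1r => ->; rewrite mulrAC.
case: (sphere_int (fun=> 1%E)) J0 Ep Eq => [j| |]//= j0 Ep Eq; last first.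
  by rewrite invr0 mule0 lee_fin.
rewrite (fin _ _ _ Sp0 Ep) (fin _ _ _ Sq0 Eq).
case: (sphere_int (fun u => (X u)%:E)) SX0 => [x| |]//= x0.
rewrite -!EFinM -!EFinD lee_fin => -[E1].
have [->|jn] := eqVneq j 0; first by rewrite invr0 mulr0.
have jp : 0 < j by rewrite lt_def jn.
rewrite ler_pdivrMr//; apply: (@le_trans _ _ (j * (A - c * (enorm p ^+ 2 / d%:R) + k * (enorm q ^+ 2 / d%:R)))).
  by rewrite le_eqVlt; apply/orP; left; apply/eqP; lra.
by rewrite mulrC ler_wpM2r.
Qed.

End SphereIntegral.

(** * Gradients and quadratic bounds for smooth functions *)

Section Smooth.
Context {R : realType}.
Variable d : nat.
Implicit Types (u v p q x z : 'rV[R]_d) (g : 'rV[R]_d -> R).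

Lemma derive_dotv g x v : differentiable g x -> 'D_v g x = dotv (grad g x) v.
Proof.
move=> dg; rewrite deriveE// {1}(row_sum_delta v) linear_sum/=.
by apply: eq_bigr => i _; rewrite linearZ/= mxE deriveE// mulrC.
Qed.

Lemma is_derive_line g x v (s : R) : differentiable g (x + s *: v) ->
  is_derive s 1 (fun s => g (x + s *: v)) (dotv (grad g (x + s *: v)) v).
Proof.
move=> dg; have dv := @diff_derivable _ _ _ g (x + s *: v) v dg.
have E : (fun h : R => h^-1 *: (g (x + (h *: (1 : R) + s) *: v) - g (x + s *: v))) =
         (fun h : R => h^-1 *: (g (h *: v + (x + s *: v)) - g (x + s *: v))).
  apply/funext => h; congr (_ *: (g _ - _)).
  by rewrite scalerDl addrCA /GRing.scale/= mulr1.
apply: DeriveDef.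
  by rewrite /derivable /= E; exact: dv.
by rewrite -derive_dotv// /derive /= E.
Qed.

(** Difference quotients along a basis vector differ from the entry of [p] by at most [K |h|]. This
    identifies the gradient of [Phi], whose differentiability is not assumed. *)
Lemma grad_unique g x p (K : R) :
  (forall v, `|g (x + v) - g x - dotv p v| <= K * enorm v ^+ 2) -> grad g x = p.
Proof.
move=> H; apply/rowP => i; rewrite mxE /derive.
have e1 : enorm (delta_mx 0 i : 'rV[R]_d) ^+ 2 = 1.
  rewrite sqr_enorm (bigD1 i)//= mxE !eqxx expr1n big1 ?addr0// => j ji.
  by rewrite mxE (negbTE ji) andbF expr0n.
have pe : dotv p (delta_mx 0 i) = p 0 i.
  rewrite /dotv (bigD1 i)//= mxE !eqxx mulr1 big1 ?addr0// => j ji.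
  by rewrite mxE (negbTE ji) andbF mulr0.
apply: cvg_lim => //; apply/cvgrPdist_le => e e0.
have K0 : 0 <= K.
  have := H (delta_mx 0 i); rewrite e1 mulr1; exact: le_trans.
near=> h.
have hn0 : h != 0 by near: h; exact: nbhs_dnbhs_neq.
have := H (h *: delta_mx 0 i); rewrite enormZ exprMn e1 mulr1 dotvZr pe real_normK ?num_real//.
rewrite (addrC x) => Hh.
have -> : p 0 i - h^-1 *: (g (h *: delta_mx 0 i + x) - g x) =
   - (h^-1 * (g (h *: delta_mx 0 i + x) - g x - h * p 0 i)).
  by rewrite /GRing.scale /=; field.
rewrite normrN normrM normfV ler_pdivrMl ?normr_gt0//.
apply: le_trans Hh _.
rewrite -[h ^+ 2]real_normK ?num_real// expr2 mulrA mulrC ler_pM2l ?normr_gt0//.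
(* [K + 1] keeps the denominator positive when [K = 0]. *)
have : `|h| <= e / (K + 1).
  near: h; apply: dnbhs0_le; by rewrite divr_gt0// ltr_wpDl.
rewrite ler_pdivlMr ?ltr_wpDl// => he; apply: le_trans he.
by rewrite mulrC ler_wpM2l// lerDl.
Unshelve. all: by end_near. Qed.

(** The mean value theorem is applied along the segment to the remainder minus its quadratic bound:
    the derivative there is nonpositive, which gives the constant [l / 2]. Both signs [sigma] give
    the absolute value. *)
Lemma smooth_taylor g (l : R) x v : (forall z, differentiable g z) ->
  (forall z, enorm (grad g z - grad g x) <= l * enorm (z - x)) ->
  `|g (x + v) - g x - dotv (grad g x) v| <= l / 2 * enorm v ^+ 2.
Proof.
move=> dg Lg.
have H (sigma : R) : `|sigma| = 1 ->
    sigma * (g (x + v) - g x - dotv (grad g x) v) <= l / 2 * enorm v ^+ 2.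
  move=> s1.
  pose psi (s : R) := sigma * (g (x + s *: v) - s * dotv (grad g x) v)
                       - l / 2 * enorm v ^+ 2 * s ^+ 2.
  pose dpsi (s : R) := sigma * (dotv (grad g (x + s *: v)) v - dotv (grad g x) v)
                       - l * enorm v ^+ 2 * s.
  have dpsiP (s : R) : is_derive s 1 psi (dpsi s).
    have dl := is_derive_line (dg (x + s *: v)).
    rewrite /psi /dpsi; apply: is_derive_eq.
    by rewrite /GRing.scale /=; field.
  have cpsi : {within `[0, 1], continuous psi}%classic.
    by apply: derivable_within_continuous => s _; case: (dpsiP s).
  have [c /andP[/= c0 c1]] := @MVT _ psi dpsi 0 1 ltr01 (fun s _ => dpsiP s) cpsi.
  rewrite !bnd_simp in c0 c1.
  rewrite subr0 mulr1 /psi /dpsi !scale1r !scale0r addr0 => E.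
  have cs : sigma * (dotv (grad g (x + c *: v)) v - dotv (grad g x) v) <=
            l * enorm v ^+ 2 * c.
    rewrite -dotvBl -dotvZr; apply: le_trans (cauchy_schwarz _ _) _.
    rewrite enormZ s1 mul1r.
    apply: (@le_trans _ _ (l * enorm (x + c *: v - x) * enorm v)).
      by apply: ler_wpM2r; [exact: enorm_ge0|exact: Lg].
    rewrite addrC addKr enormZ gtr0_norm//.
    by rewrite le_eqVlt; apply/orP; left; apply/eqP; ring.
  by move: E cs; rewrite expr1n expr0n/=; lra.
have H1 := H 1 (normr1 _); have H2 := H (-1).
rewrite normrN normr1 in H2; have {}H2 := H2 erefl.
by rewrite ler_norml; apply/andP; split; lra.
Qed.

(** The quadratic is evaluated at its minimizer [- p / K]. For a nonnegative function that is
    [K]-smooth from above, this bounds the squared gradient by the value. *)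
Lemma sqr_enorm_le_of_minorant p (h0 K : R) : 0 < K ->
  (forall v, 0 <= h0 + dotv p v + K / 2 * enorm v ^+ 2) ->
  enorm p ^+ 2 <= 2 * K * h0.
Proof.
move=> K0 /(_ (- K^-1 *: p)).
rewrite dotvZr enormZ exprMn real_normK ?num_real// dotvv => H.
suff : 0 <= 2 * K * (h0 + - K^-1 * enorm p ^+ 2 + K / 2 * ((- K^-1) ^+ 2 * enorm p ^+ 2)).
  suff -> : 2 * K * (h0 + - K^-1 * enorm p ^+ 2 + K / 2 * ((- K^-1) ^+ 2 * enorm p ^+ 2))
    = 2 * K * h0 - enorm p ^+ 2 by rewrite subr_ge0.
  by field; rewrite gt_eqF.
by rewrite mulr_ge0// mulr_ge0// ltW.
Qed.

End Smooth.

(** * Expectation over all directions of the run *)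

Section ExpectDirs.
Context {R : realType}.
Variables d1 d2 : nat.
Implicit Types (g h : (nat -> 'rV[R]_d1) -> (nat -> 'rV[R]_d2) -> \bar R).

Lemma expect_dirs_ge0 t g : (forall us vs, 0 <= g us vs)%E ->
  (0 <= expect_dirs t g)%E.
Proof.
elim: t g => [|t IH] g g0 /=; first exact: g0.
by apply: IH => us vs; do 2 (apply: sphere_expect_ge0 => ? ?).
Qed.

Lemma expect_dirs_le t g h : (forall us vs, 0 <= g us vs)%E ->
  (forall us vs, g us vs <= h us vs)%E ->
  (expect_dirs t g <= expect_dirs t h)%E.
Proof.
elim: t g h => [|t IH] g h g0 gh /=; first exact: gh.
apply: IH => us vs; first by do 2 (apply: sphere_expect_ge0 => ? ?).
apply: sphere_expect_le => u _; first exact: sphere_expect_ge0.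
exact: sphere_expect_le.
Qed.

Lemma expect_dirsD_ge t g h : (forall us vs, 0 <= g us vs)%E ->
  (forall us vs, 0 <= h us vs)%E ->
  (expect_dirs t g + expect_dirs t h <=
   expect_dirs t (fun us vs => g us vs + h us vs))%E.
Proof.
elim: t g h => [|t IH] g h g0 h0 //=.
apply: le_trans; first by apply: IH => us vs; do 2 (apply: sphere_expect_ge0 => ? ?).
apply: expect_dirs_le => us vs.
  by rewrite adde_ge0//; do 2 (apply: sphere_expect_ge0 => ? ?).
apply: le_trans; first by apply: sphere_expectD_ge => u _; exact: sphere_expect_ge0.
apply: sphere_expect_le => u _; first by rewrite adde_ge0// sphere_expect_ge0.
exact: sphere_expectD_ge.
Qed.

Lemma expect_dirsD_cst_le t g (c : R) : (forall us vs, 0 <= g us vs)%E -> 0 <= c ->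
  (expect_dirs t (fun us vs => g us vs + c%:E) <= expect_dirs t g + c%:E)%E.
Proof.
move=> g0 c0; elim: t g g0 => [|t IH] g g0 //=.
apply: le_trans; last first.
  by apply: IH => us vs; do 2 (apply: sphere_expect_ge0 => ? ?).
have gc0 us vs : (0 <= g us vs + c%:E)%E by rewrite adde_ge0.
apply: expect_dirs_le => us vs; first by do 2 (apply: sphere_expect_ge0 => ? ?).
apply: le_trans; last first.
  by apply: sphere_expectD_cst_le => // u _; exact: sphere_expect_ge0.
apply: sphere_expect_le => u _; first exact: sphere_expect_ge0.
exact: sphere_expectD_cst_le.
Qed.

(** Iterate [k] uses only the directions of index below [k], so changing those of index [t] first
    affects iterate [t + 1]. *)
Lemma zo_agda_upd f (alpha beta mu1 mu2 : R) x0 y0 us vs t (u : 'rV[R]_d1) (v : 'rV[R]_d2) k :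
  (k <= t)%N ->
  zo_agda f alpha beta mu1 mu2 x0 y0 (upd us t u) (upd vs t v) k =
  zo_agda f alpha beta mu1 mu2 x0 y0 us vs k.
Proof.
by elim: k => [//|k IH] kt /=; rewrite IH ?(ltnW kt)// /upd ltn_eqF.
Qed.

End ExpectDirs.

(** * Scalar inequalities behind one ascent and one descent step *)

Section OneStepAlgebra.
Context {R : realType}.
Implicit Types (D T s p eta r alpha beta l L : R).

(** Here [D] is the dimension, [T] the inner product of the y-gradient with the direction and [s]
    the finite-difference error. The curvature term and Young's inequality for [s T] each consume a
    quarter of [beta D T^2], leaving half; they cost [1/4 + 1 = 5/4] of [beta s^2]. *)
Lemma ascent_step_bound D T s beta l : 1 <= D -> 0 < beta -> 0 < l ->
  beta * D * l <= 1 / 4 ->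
  beta * D / 2 * T ^+ 2 - 5 / 4 * beta * s ^+ 2 <=
  beta * (D * T + s) * T - l / 2 * (beta * (D * T + s)) ^+ 2.
Proof.
move=> D1 b0 l0 bDl.
have D0 : 0 < D by lra.
have h1 : l / 2 * (beta * (D * T + s)) ^+ 2 <= beta * (D * T ^+ 2 / 4 + s ^+ 2 / 4).
  have e1 : D * (beta * l) * (D * T + s) ^+ 2 <= 1 / 4 * (D * T + s) ^+ 2.
    by apply: ler_wpM2r; [exact: sqr_ge0|lra].
  have e2 : (D * T + s) ^+ 2 <= 2 * (D ^+ 2 * T ^+ 2 + s ^+ 2).
    by have := sqr_ge0 (D * T - s); nra.
  have e3 : s ^+ 2 <= D * s ^+ 2 by have := sqr_ge0 s; nra.
  have e4 : D * (beta * l * (D * T + s) ^+ 2) <= D * ((D * T ^+ 2 + s ^+ 2) / 2).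
    by nra.
  rewrite ler_pM2l// in e4.
  have -> : l / 2 * (beta * (D * T + s)) ^+ 2 =
    beta * (beta * l * (D * T + s) ^+ 2 / 2) by field.
  by rewrite ler_pM2l//; lra.
have h2 : - (D * T ^+ 2 / 4 + s ^+ 2) <= s * T.
  have := sqr_ge0 (T / 2 + s); have : T ^+ 2 <= D * T ^+ 2.
    by have := sqr_ge0 T; nra.
  nra.
have h3 := ler_wpM2l (ltW b0) h2.
nra.
Qed.

(** [p] and [eta] are the inner products of the direction with the gradient of [Phi] and with the
    gradient error, [r] is the finite-difference error and [w] the contraction rate of the gap. The
    left side bounds the change of [2 Phi + (1 - w) (Phi - f)]. The coefficient of [p^2] is [- 6/5]
    from the main form plus [1/2] from Young's inequality for [r]. *)
Lemma descent_step_bound D p eta r w alpha L : 1 <= D -> 0 < alpha -> 0 < L ->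
  10 * (alpha * D * L) <= 1 -> 0 <= w <= 1 ->
  alpha * (D * (p + eta) + r) * ((1 - w) * eta - 2 * p) +
    3 * L * (alpha * (D * (p + eta) + r)) ^+ 2 <=
  - (7 / 10 * alpha * D) * p ^+ 2 + 3 * alpha * D * eta ^+ 2 + 18 / 5 * alpha * r ^+ 2.
Proof.
move=> D1 a0 L0 aDL /andP[w0 w1].
have D0 : 0 < D by lra.
have h1 : 3 * L * (alpha * (D * (p + eta) + r)) ^+ 2 <=
    alpha * (3 / 5 * D * (p + eta) ^+ 2 + 3 / 5 * r ^+ 2).
  have e1 : (10 * (alpha * D * L)) * (D * (p + eta) + r) ^+ 2 <= 1 * (D * (p + eta) + r) ^+ 2.
    by apply: ler_wpM2r; [exact: sqr_ge0|lra].
  have e2 : (D * (p + eta) + r) ^+ 2 <= 2 * (D ^+ 2 * (p + eta) ^+ 2 + r ^+ 2).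
    by have := sqr_ge0 (D * (p + eta) - r); nra.
  have e3 : r ^+ 2 <= D * r ^+ 2 by have := sqr_ge0 r; nra.
  have e4 : D * (alpha * L * (D * (p + eta) + r) ^+ 2) <=
            D * ((D * (p + eta) ^+ 2 + r ^+ 2) / 5) by nra.
  rewrite ler_pM2l// in e4.
  have -> : 3 * L * (alpha * (D * (p + eta) + r)) ^+ 2 =
    alpha * (3 * (alpha * L * (D * (p + eta) + r) ^+ 2)) by ring.
  by rewrite ler_pM2l//; lra.
have h2 : r * ((1 - w) * eta - 2 * p) <= D * (p ^+ 2 / 2 + eta ^+ 2 / 4) + 3 * r ^+ 2.
  have e1 : p ^+ 2 / 2 + eta ^+ 2 / 4 <= D * (p ^+ 2 / 2 + eta ^+ 2 / 4).
    by have := sqr_ge0 p; have := sqr_ge0 eta; nra.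
  have e2 := sqr_ge0 (p / 2 + r).
  have e3 := sqr_ge0 (eta / 2 - (1 - w) * r).
  have e4 : ((1 - w) * r) ^+ 2 <= r ^+ 2.
    by rewrite exprMn ler_piMl ?sqr_ge0// expr_le1//; lra.
  nra.
have h3 : (p + eta) * ((1 - w) * eta - 2 * p) + 3 / 5 * (p + eta) ^+ 2 <=
   - (6 / 5) * p ^+ 2 + 12 / 5 * eta ^+ 2.
  (* The cross terms add up to [(1/5 - w) p eta], and [|1/5 - w| <= 4/5]. *)
  have : (1 / 5 - w) * (p * eta) <= p ^+ 2 / 5 + 4 / 5 * eta ^+ 2.
    have f1 := sqr_ge0 (p - 2 * eta); have f2 := sqr_ge0 (p + 2 * eta).
    have f3 : p * eta <= (p ^+ 2 + 4 * eta ^+ 2) / 4 by nra.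
    have f4 : - (p * eta) <= (p ^+ 2 + 4 * eta ^+ 2) / 4 by nra.
    have f5 : 0 <= p ^+ 2 + 4 * eta ^+ 2 by have := sqr_ge0 p; have := sqr_ge0 eta; lra.
    nra.
  have := sqr_ge0 eta; nra.
have h4 := ler_wpM2l (ltW D0) h3.
suff : (D * (p + eta) + r) * ((1 - w) * eta - 2 * p) +
     (3 / 5 * D * (p + eta) ^+ 2 + 3 / 5 * r ^+ 2) <=
     - (7 / 10 * D) * p ^+ 2 + 3 * D * eta ^+ 2 + 18 / 5 * r ^+ 2.
  move=> /(ler_wpM2l (ltW a0)); lra.
have := sqr_ge0 eta; nra.
Qed.

End OneStepAlgebra.

(** * Consequences of the PL inequality and expected decay in one iteration *)

Section PLMinimax.
Context {R : realType}.
Variables (d1 d2 : nat) (f : 'rV[R]_d1 -> 'rV[R]_d2 -> R) (Phi : 'rV[R]_d1 -> R).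
Variables (Phistar mu l : R).
Implicit Types (x : 'rV[R]_d1) (y : 'rV[R]_d2).
Local Notation gradx x y := (grad (fun x' => f x' y) x).
Local Notation grady x y := (grad (fun y' => f x y') y).
Hypothesis hdx : forall x y, differentiable (fun x' => f x' y) x.
Hypothesis hdy : forall x y, differentiable (fun y' => f x y') y.
Hypothesis hPhi : forall x, (exists y, f x y = Phi x) /\ (forall y, f x y <= Phi x).
Hypothesis hmu : 0 < mu.
Hypothesis hPL : forall x y, enorm (grady x y) ^+ 2 >= 2 * mu * (Phi x - f x y).
Hypothesis hl : 0 < l.
Hypothesis hLx : forall x1 x2 y1 y2,
  enorm (gradx x1 y1 - gradx x2 y2) <= l * (enorm (x1 - x2) + enorm (y1 - y2)).
Hypothesis hLy : forall x1 x2 y1 y2,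
  enorm (grady x1 y1 - grady x2 y2) <= l * (enorm (x1 - x2) + enorm (y1 - y2)).
Hypothesis hPhistar : forall x, Phistar <= Phi x.

Let enorm_subvv d (v : 'rV[R]_d) : enorm (v - v) = 0.
Proof. by apply/eqP; rewrite enorm_eq0 subrr. Qed.

Lemma taylor_x x y v :
  `|f (x + v) y - f x y - dotv (gradx x y) v| <= l / 2 * enorm v ^+ 2.
Proof.
apply: (@smooth_taylor _ _ (fun x' => f x' y)) => [z|z]; first exact: hdx.
by have := hLx z x y y; rewrite enorm_subvv addr0.
Qed.

Lemma taylor_y x y v :
  `|f x (y + v) - f x y - dotv (grady x y) v| <= l / 2 * enorm v ^+ 2.
Proof.
apply: (@smooth_taylor _ _ (fun y' => f x y')) => [z|z]; first exact: hdy.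
by have := hLy x x z y; rewrite enorm_subvv add0r.
Qed.

Lemma gap_ge0 x y : 0 <= Phi x - f x y.
Proof. by rewrite subr_ge0; exact: (hPhi x).2. Qed.

(** A converse to PL: the gap is nonnegative and [l]-smooth in [y]. *)
Lemma sqr_grady_le x y : enorm (grady x y) ^+ 2 <= 2 * l * (Phi x - f x y).
Proof.
have -> : enorm (grady x y) ^+ 2 = enorm (- grady x y) ^+ 2.
  by rewrite -scaleN1r enormZ normrN normr1 mul1r.
apply: sqr_enorm_le_of_minorant => // v; rewrite dotvNl.
have := taylor_y x y v; rewrite ler_norml => /andP[H _].
by have := (hPhi x).2 (y + v); lra.
Qed.

(** PL and its converse give [mu <= l] only where the gap is positive, so the gap stays as a
    factor. *)
Lemma gap_condition x y : mu * (Phi x - f x y) <= l * (Phi x - f x y).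
Proof. by have := sqr_grady_le x y; have := hPL x y; lra. Qed.

(* With [y] a maximizer for [x], the PL inequality at [(x + v, y)] bounds
   [Phi (x + v) - f (x + v) y] by the square of the y-gradient there, which is
   at most [l |v|] because it vanishes at [(x, y)]. *)
Lemma Phi_taylor x v :
  - (l / 2) * enorm v ^+ 2 <= Phi (x + v) - Phi x - dotv (grad Phi x) v
    <= (l + l ^+ 2 / mu) / 2 * enorm v ^+ 2.
Proof.
have [[y fy] _] := hPhi x.
have gy0 : enorm (grady x y) = 0.
  apply/eqP; rewrite -sqrf_eq0 eq_le sqr_ge0 andbT.
  by have := sqr_grady_le x y; rewrite fy subrr mulr0.
have K u : - (l / 2) * enorm u ^+ 2 <= Phi (x + u) - Phi x - dotv (gradx x y) u
    <= (l + l ^+ 2 / mu) / 2 * enorm u ^+ 2.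
  have := taylor_x x y u; rewrite ler_norml fy => /andP[H1 H2].
  have H3 := (hPhi (x + u)).2 y.
  apply/andP; split; first by lra.
  have H4 : enorm (grady (x + u) y) <= l * enorm u.
    have := hLy (x + u) x y y; rewrite enorm_subvv addr0 (addrC x) addrK.
    have -> : grady x y = 0 by apply/eqP; rewrite -enorm_eq0 gy0.
    by rewrite subr0.
  have H5 : enorm (grady (x + u) y) ^+ 2 <= l ^+ 2 * enorm u ^+ 2.
    by rewrite -exprMn ler_pXn2r// ?nnegrE ?enorm_ge0// mulr_ge0 ?enorm_ge0// ltW.
  have H6 : Phi (x + u) - f (x + u) y <= l ^+ 2 / mu / 2 * enorm u ^+ 2.
    have := le_trans (hPL (x + u) y) H5.
    rewrite -ler_pdivlMl ?mulr_gt0// => H; apply: le_trans H _.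
    by rewrite le_eqVlt; apply/orP; left; apply/eqP; field; rewrite gt_eqF.
  lra.
suff -> : grad Phi x = gradx x y by exact: K.
apply: (@grad_unique _ _ _ _ _ ((l + l ^+ 2 / mu) / 2)) => u.
have /andP[K1 K2] := K u; rewrite ler_norml K2 andbT.
apply: le_trans K1; have : 0 <= l ^+ 2 / mu * enorm u ^+ 2.
  by rewrite mulr_ge0 ?sqr_ge0// divr_ge0 ?sqr_ge0// ltW.
lra.
Qed.

Let C0 : 0 < l + l ^+ 2 / mu.
Proof. by rewrite addr_gt0// divr_gt0// exprn_gt0. Qed.

Lemma sqr_gradPhi_le x :
  enorm (grad Phi x) ^+ 2 <= 2 * (l + l ^+ 2 / mu) * (Phi x - Phistar).
Proof.
apply: sqr_enorm_le_of_minorant => // v.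
have /andP[_ H] := Phi_taylor x v; have := hPhistar (x + v); lra.
Qed.

Lemma sqr_grad_diff_le x y :
  enorm (gradx x y - grad Phi x) ^+ 2 <=
  2 * (2 * l + l ^+ 2 / mu) * (Phi x - f x y).
Proof.
have -> : enorm (gradx x y - grad Phi x) ^+ 2 = enorm (grad Phi x - gradx x y) ^+ 2.
  by rewrite -opprB -scaleN1r enormZ normrN normr1 mul1r.
apply: sqr_enorm_le_of_minorant => [|v]; first by have := C0; have := hl; lra.
have /andP[_ H] := Phi_taylor x v.
have := taylor_x x y v; rewrite ler_norml => /andP[H1 _].
by have := (hPhi (x + v)).2 y; rewrite dotvBl; lra.
Qed.

Let quotient_error (D m T df : R) : 0 < D -> 0 < m ->
  `|df - m * T| <= l / 2 * m ^+ 2 ->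
  (df / (m / D) - D * T) ^+ 2 <= (D * l * m / 2) ^+ 2.
Proof.
move=> D0 m0 H.
have -> : df / (m / D) - D * T = D / m * (df - m * T).
  by field; rewrite !gt_eqF.
rewrite -(real_normK (num_real (_ * _))) ler_pXn2r// ?nnegrE//; last first.
  by rewrite divr_ge0// !mulr_ge0// ltW.
rewrite normrM gtr0_norm ?divr_gt0//.
apply: (@le_trans _ _ (D / m * (l / 2 * m ^+ 2))).
  by rewrite ler_wpM2l// divr_ge0// ltW.
by rewrite le_eqVlt; apply/orP; left; apply/eqP; field; rewrite gt_eqF.
Qed.

(** On average the squared inner product is [|grad_y f|^2 / d2], which PL turns into contraction of
    the gap. [K] and [c] carry the part of the Lyapunov function that is constant in [v], and [w]
    leaves room for a slower rate. *)
Lemma ascent_step (K c w beta m : R) x y : (0 < d2)%N ->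
  0 <= K -> 0 <= c -> 0 <= w <= 1 -> 0 < beta -> 0 < m -> w <= beta * mu ->
  beta * d2%:R * l <= 1 / 4 ->
  (sphere_expect (fun v => (K + c * (Phi x - f x (y +
      (beta * ((f x (y + m *: v) - f x y) / (m / d2%:R))) *: v)))%:E)
   <= (K + c * ((1 - w) * (Phi x - f x y) +
          5 / 4 * beta * (d2%:R * l * m / 2) ^+ 2))%:E)%E.
Proof.
move=> hd K0 c0 /andP[w0 w1] b0 m0 wb bl.
have D1 : (1 : R) <= d2%:R by rewrite ler1n.
have D0 : (0 : R) < d2%:R by lra.
set D : R := d2%:R in D1 D0 bl *; set rho := D * l * m / 2.
have G0 := gap_ge0 x y; set G := Phi x - f x y in G0 *.
have N0 : 0 <= 5 / 4 * beta * rho ^+ 2 by rewrite mulr_ge0 ?sqr_ge0//; lra.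
apply: (@sphere_expect_quad_le _ _ _ (K + c * (G + 5 / 4 * beta * rho ^+ 2))
   (c * (beta * D / 2)) 0 _ (grady x y) 0) => //.
- by move=> u _; rewrite lee_fin addr_ge0// mulr_ge0// gap_ge0.
- by rewrite addr_ge0// mulr_ge0// addr_ge0.
- by rewrite mulr_ge0// divr_ge0// mulr_ge0// ltW.
- by rewrite addr_ge0// mulr_ge0// addr_ge0// mulr_ge0// subr_ge0.
- move=> v v1; rewrite lee_fin mul0r addr0.
  set T := dotv (grady x y) v.
  set g := (_ - _) / _; set s := g - D * T.
  have hs : s ^+ 2 <= rho ^+ 2.
    apply: quotient_error => //; have := taylor_y x y (m *: v).
    by rewrite dotvZr enormZ v1 mulr1 (gtr0_norm m0).
  have := taylor_y x y ((beta * g) *: v); rewrite dotvZr enormZ v1 mulr1.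
  rewrite real_normK ?num_real// -/T ler_norml => /andP[H _].
  have gE : g = D * T + s by rewrite /s addrC subrK.
  have := ascent_step_bound T s D1 b0 hl bl; rewrite -gE => H2.
  have H3 : 5 / 4 * beta * s ^+ 2 <= 5 / 4 * beta * rho ^+ 2.
    by rewrite ler_wpM2l//; lra.
  suff : Phi x - f x (y + (beta * g) *: v) <=
         (G + 5 / 4 * beta * rho ^+ 2) - beta * D / 2 * T ^+ 2.
    by move=> /(ler_wpM2l c0); lra.
  by rewrite /G; lra.
- rewrite mul0r addr0.
  have -> : c * (beta * D / 2) * (enorm (grady x y) ^+ 2 / D) =
            c * (beta / 2 * enorm (grady x y) ^+ 2) by field; rewrite gt_eqF.
  suff : (G + 5 / 4 * beta * rho ^+ 2) - beta / 2 * enorm (grady x y) ^+ 2 <=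
         (1 - w) * G + 5 / 4 * beta * rho ^+ 2.
    by move=> /(ler_wpM2l c0); lra.
  have H1 := ler_wpM2l (ltW b0) (hPL x y).
  have H2 := ler_wpM2r G0 wb; rewrite -/G in H1.
  by lra.
Qed.

(** Averages over [u] what the ascent step leaves: the gap contracted by [1 - w] and the ascent
    noise [n]. *)
Lemma descent_step (c n w alpha m L B : R) x y : (0 < d1)%N ->
  0 <= c -> 0 <= n -> 0 <= w <= 1 -> 0 < alpha -> 0 < m ->
  3 * l + 3 / 2 * (l ^+ 2 / mu) <= 3 * L ->
  10 * (alpha * d1%:R * L) <= 1 -> 0 <= B ->
  2 * (Phi x - Phistar) + (1 - w) * (Phi x - f x y) + n
     + 18 / 5 * alpha * (d1%:R * l * m / 2) ^+ 2
     - 7 / 10 * alpha * enorm (grad Phi x) ^+ 2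
     + 3 * alpha * enorm (gradx x y - grad Phi x) ^+ 2 <= B ->
  (sphere_expect (fun u =>
     let x' := (x - (alpha * ((f (x + m *: u) y - f x y) / (m / d1%:R))) *: u)%R in
     (c * (2 * (Phi x' - Phistar) + ((1 - w) * (Phi x' - f x' y) + n)))%:E)
   <= (c * B)%:E)%E.
Proof.
move=> hd c0 n0 w01 a0 m0 hL aL B0.
have /andP[w0 w1] := w01.
have D1 : (1 : R) <= d1%:R by rewrite ler1n.
have D0 : (0 : R) < d1%:R by lra.
set D : R := d1%:R in D1 D0 aL *; set rho := D * l * m / 2.
set P := grad Phi x; set e := gradx x y - P.
have G0 := gap_ge0 x y; set G := Phi x - f x y in G0 *.
have F0 x' : 0 <= Phi x' - Phistar by rewrite subr_ge0.
have C0' := C0; have l0 := hl.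
have L0 : 0 < L by lra.
have N0 : 0 <= 18 / 5 * alpha * rho ^+ 2 by rewrite mulr_ge0 ?sqr_ge0//; lra.
have wG0 x' : 0 <= (1 - w) * (Phi x' - f x' y) by rewrite mulr_ge0 ?gap_ge0// subr_ge0.
move=> HB.
pose A := 2 * (Phi x - Phistar) + (1 - w) * G + n + 18 / 5 * alpha * rho ^+ 2.
have A0 : 0 <= A.
  by rewrite /A; have := F0 x; have := wG0 x; rewrite -/G; lra.
apply: (@sphere_expect_quad_le _ _ _ (c * A) (c * (7 / 10 * alpha * D))
   (c * (3 * alpha * D)) _ P e) => //.
- move=> u _; rewrite lee_fin mulr_ge0//; have := F0 (x - (alpha * ((f (x + m *: u) y - f x y) / (m / D))) *: u).
  by have := wG0 (x - (alpha * ((f (x + m *: u) y - f x y) / (m / D))) *: u); lra.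
- by rewrite mulr_ge0.
- by rewrite mulr_ge0// mulr_ge0//; lra.
- by rewrite mulr_ge0// mulr_ge0//; lra.
- by rewrite mulr_ge0.
- move=> u u1 /=; rewrite lee_fin.
  set p := dotv P u; set eta := dotv e u.
  set g := (_ - _) / _.
  have aE : dotv (gradx x y) u = p + eta by rewrite /p /eta -dotvDl addrC subrK.
  set r := g - D * (p + eta).
  have hr : r ^+ 2 <= rho ^+ 2.
    apply: quotient_error => //; have := taylor_x x y (m *: u).
    by rewrite dotvZr aE enormZ u1 mulr1 (gtr0_norm m0).
  have nE : enorm (- ((alpha * g) *: u)) ^+ 2 = (alpha * g) ^+ 2.
    by rewrite -scaleNr enormZ u1 mulr1 real_normK ?num_real// sqrrN.
  have := taylor_x x y (- ((alpha * g) *: u)).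
  rewrite nE -scaleNr dotvZr aE ler_norml => /andP[H1 _].
  have /andP[_] := Phi_taylor x (- ((alpha * g) *: u)).
  rewrite nE -scaleNr dotvZr -/P -/p => H2.
  set x' := x + _ in H1 H2 *.
  have gE : g = D * (p + eta) + r by rewrite /r addrC subrK.
  have := descent_step_bound p eta r D1 a0 L0 aL w01; rewrite -gE => H3.
  have H4 : 18 / 5 * alpha * r ^+ 2 <= 18 / 5 * alpha * rho ^+ 2.
    by rewrite ler_wpM2l//; lra.
  suff : 2 * (Phi x' - Phistar) + ((1 - w) * (Phi x' - f x' y) + n) <=
     A - (7 / 10 * alpha * D) * p ^+ 2 + (3 * alpha * D) * eta ^+ 2.
    by move=> /(ler_wpM2l c0); lra.
  have t0 : 0 <= (alpha * g) ^+ 2 by exact: sqr_ge0.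
  set t := alpha * g in H1 H2 H3 t0 *.
  have w10 : 0 <= 1 - w by rewrite subr_ge0.
  (* To first order [f] changes by [- t (p + eta)] and [Phi] by [- t p], so [p] cancels in the
     gap. *)
  have H5 : Phi x' - f x' y <= G + t * eta + (l + l ^+ 2 / mu / 2) * t ^+ 2.
    by rewrite /G; lra.
  have H6 := ler_wpM2l w10 H5.
  have l2 : 0 <= l ^+ 2 / mu by rewrite divr_ge0 ?sqr_ge0// ltW.
  have q0 : 0 <= (l + l ^+ 2 / mu / 2) * t ^+ 2.
    by rewrite mulr_ge0//; lra.
  have H7 : (3 * l + 3 / 2 * (l ^+ 2 / mu)) * t ^+ 2 <= 3 * L * t ^+ 2.
    by rewrite ler_wpM2r.
  have H8 : 0 <= w * ((l + l ^+ 2 / mu / 2) * t ^+ 2) by rewrite mulr_ge0.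
  have H9 : 0 <= l * t ^+ 2 by rewrite mulr_ge0// ltW.
  rewrite /A; lra.
- rewrite -/P -/e in HB *.
  have -> : c * A - c * (7 / 10 * alpha * D) * (enorm P ^+ 2 / D) +
    c * (3 * alpha * D) * (enorm e ^+ 2 / D) =
    c * (A - 7 / 10 * alpha * enorm P ^+ 2 + 3 * alpha * enorm e ^+ 2).
    by field; rewrite gt_eqF.
  by rewrite ler_wpM2l.
Qed.

Definition lyapunov x y : R := 2 * (Phi x - Phistar) + (Phi x - f x y).

Lemma lyapunov_ge0 x y : 0 <= lyapunov x y.
Proof. by rewrite addr_ge0 ?gap_ge0// mulr_ge0// subr_ge0. Qed.

Lemma agda_step (c alpha beta m1 m2 L eps : R) x y :
  (0 < d1)%N -> (0 < d2)%N -> 0 <= c -> 0 < alpha -> 0 < beta ->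
  0 < m1 -> 0 < m2 -> L = l + l ^+ 2 / mu / 2 ->
  4 * (beta * d2%:R * L) <= 1 -> 10 * (alpha * d1%:R * L) <= 1 ->
  32 * (alpha * (l ^+ 2 / mu)) <= beta * mu ->
  (d1%:R * l * m1 / 2) ^+ 2 <= eps ^+ 2 / 24 ->
  beta * (d2%:R * l * m2 / 2) ^+ 2 <= alpha * eps ^+ 2 / 12 ->
  (sphere_expect (fun u => sphere_expect (fun v =>
     let x' := (x - (alpha * ((f (x + m1 *: u) y - f x y) / (m1 / d1%:R))) *: u)%R in
     let y' := (y + (beta * ((f x' (y + m2 *: v) - f x' y) / (m2 / d2%:R))) *: v)%R in
     (c * lyapunov x' y')%:E))
   <= (c * (lyapunov x y - 7 / 10 * alpha * enorm (grad Phi x) ^+ 2 +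
            9 / 20 * alpha * eps ^+ 2))%:E)%E.
Proof.
move=> hd1 hd2 c0 a0 b0 m10 m20 hL bL aL ab rho1 rho2.
have l0 := hl; have mu0 := hmu.
have q0 : 0 < l ^+ 2 / mu by rewrite divr_gt0// exprn_gt0.
have qmu : l ^+ 2 / mu * mu = l * l by rewrite mulfVK ?gt_eqF// expr2.
have L0 : 0 < L by lra.
have D11 : (1 : R) <= d1%:R by rewrite ler1n.
have D21 : (1 : R) <= d2%:R by rewrite ler1n.
have aL1 : alpha * L <= 1 / 10.
  have : alpha * L <= alpha * L * d1%:R by rewrite ler_peMr// mulr_ge0 ?ltW.
  lra.
have bl : beta * d2%:R * l <= 1 / 4.
  have : beta * d2%:R * l <= beta * d2%:R * L.
    by rewrite ler_wpM2l ?mulr_ge0 ?ltW//; lra.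
  lra.
have bl1 : beta * l <= 1 / 4.
  have : beta * l <= beta * l * d2%:R by rewrite ler_peMr// mulr_ge0 ?ltW.
  lra.
have al1 : alpha * l <= 1 / 10.
  have : alpha * l <= alpha * L by rewrite ler_wpM2l ?ltW//; lra.
  lra.
set q := l ^+ 2 / mu in hL ab q0 qmu *.
(* The rate that absorbs the gradient error: [3 alpha * 2 (2 l + q) G <= 18 alpha q G], because
   [l G <= q G] by [gap_condition]. It is at most [beta mu] since [32 alpha q] is. *)
pose w := 18 * (alpha * q).
have aq0 : 0 < alpha * q by exact: mulr_gt0.
(* [beta mu] may exceed 1. If [w > 1], then [beta mu > 16/9]; with [beta l <= 1/4] this gives
   [q <= 9/64 l], and [alpha l <= 1/10] then contradicts [w > 1]. *)
have w1 : w <= 1.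
  rewrite leNgt; apply/negP => wgt.
  have bm : 16 / 9 <= beta * mu by rewrite /w in wgt; lra.
  have h1 : l * (16 / 9) <= mu / 4.
    have e1 := ler_wpM2l (ltW l0) bm; have e2 := ler_wpM2r (ltW mu0) bl1; lra.
  have h2 : q <= 9 / 64 * l.
    rewrite -(ler_pM2r mu0) qmu; have := ler_wpM2l (ltW l0) h1; lra.
  have := ler_wpM2l (ltW a0) h2; rewrite /w in wgt; lra.
have w01 : 0 <= w <= 1 by rewrite w1 andbT /w; lra.
have wb : w <= beta * mu by rewrite /w; lra.
have G0 := gap_ge0 x y; set G := Phi x - f x y in G0 *.
have F0 x' : 0 <= Phi x' - Phistar by rewrite subr_ge0.
set n := 5 / 4 * beta * (d2%:R * l * m2 / 2) ^+ 2.
have n0 : 0 <= n by rewrite /n mulr_ge0 ?sqr_ge0//; lra.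
have N0 : 0 <= alpha * eps ^+ 2 by rewrite mulr_ge0 ?sqr_ge0// ltW.
(* Ensures that the bound [B] passed to [descent_step] is nonnegative. *)
have PB : alpha * enorm (grad Phi x) ^+ 2 <= 2 / 5 * (Phi x - Phistar).
  have := ler_wpM2l (ltW a0) (sqr_gradPhi_le x); rewrite -/q => H.
  apply: (le_trans H).
  have : alpha * (l + q) <= 1 / 5.
    by move: aL1; rewrite hL; have := mulr_gt0 a0 l0; lra.
  by move=> /(ler_wpM2r (F0 x)); lra.
have eB : 3 * alpha * enorm (gradx x y - grad Phi x) ^+ 2 <= w * G.
  have H1 := ler_wpM2l (ltW a0) (sqr_grad_diff_le x y); rewrite -/q -/G in H1.
  have H2 : l * G <= q * G.
    rewrite -(ler_pM2l mu0).
    have := ler_wpM2l (ltW l0) (gap_condition x y); rewrite -/G => H2.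
    by apply: le_trans (_ : l * (l * G) <= _); [lra|rewrite mulrA -qmu; lra].
  have := ler_wpM2l (ltW a0) H2; rewrite /w; lra.
apply: le_trans; last first.
  apply: (@descent_step c n w alpha m1 L _ x y) => //.
  - by rewrite -/q hL; lra.
  - by rewrite /lyapunov -/G; have := F0 x; lra.
  (* The noise adds up to [5/4 * 1/12 + 18/5 * 1/24 = 61/240 <= 9/20] of [alpha eps^2]. *)
  - have := ler_wpM2l (ltW a0) rho1; rewrite /lyapunov -/G /n; lra.
apply: sphere_expect_le => u u1.
  by apply: sphere_expect_ge0 => v v1 /=; rewrite lee_fin mulr_ge0 ?lyapunov_ge0.
move=> /=; set x' := x - _.
have K0 : 0 <= c * (2 * (Phi x' - Phistar)) by rewrite mulr_ge0// mulr_ge0.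
have := @ascent_step _ c w beta m2 x' y hd2 K0 c0 w01 b0 m20 wb bl.
rewrite -/n -mulrDr; apply: le_trans; apply: sphere_expect_le => v v1.
  by rewrite lee_fin mulr_ge0 ?lyapunov_ge0.
by rewrite -mulrDr.
Qed.

End PLMinimax.

(** * Telescoping along the run and the iteration bound *)

Unset Implicit Arguments.

Theorem theorem1 (R : realType) (d1 d2 : nat) (hd1 : (0 < d1)%N) (hd2 : (0 < d2)%N)
  (f : 'rV[R]_d1 -> 'rV[R]_d2 -> R) (Phi : 'rV[R]_d1 -> R) (Phistar : R)
  (mu l kappa L eps alpha beta theta1 mu1 mu2 : R)
  (x0 : 'rV[R]_d1) (y0 : 'rV[R]_d2)
  (* f is differentiable in each block of variables *)
  (hdx : forall x y, differentiable (fun x' => f x' y) x)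
  (hdy : forall x y, differentiable (fun y' => f x y') y)
  (* (i) Phi x = max_y f(x,y) is attained and finite *)
  (hPhi : forall x, (exists y, f x y = Phi x) /\ (forall y, f x y <= Phi x))
  (hmu : 0 < mu)
  (hPL : forall x y,
     enorm (grad (fun y' => f x y') y) ^+ 2 >= 2 * mu * (Phi x - f x y))
  (* (ii) Lipschitz gradients *)
  (hl : 0 < l)
  (hLx : forall x1 x2 y1 y2,
     enorm (grad (fun x' => f x' y1) x1 - grad (fun x' => f x' y2) x2)
       <= l * (enorm (x1 - x2) + enorm (y1 - y2)))
  (hLy : forall x1 x2 y1 y2,
     enorm (grad (fun y' => f x1 y') y1 - grad (fun y' => f x2 y') y2)
       <= l * (enorm (x1 - x2) + enorm (y1 - y2)))
  (* Phi^* = min_x Phi(x) exists and is finite *)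
  (hPhistar : (exists x, Phi x = Phistar) /\ (forall x, Phistar <= Phi x))
  (hkappa : kappa = l / mu)
  (hL : L = l + l ^+ 2 / (2 * mu))
  (heps : 0 < eps)
  (hbeta0 : 0 < beta) (hbeta : beta <= 1 / (4 * d2%:R * L))
  (halpha0 : 0 < alpha)
  (halpha : alpha <= Num.min (beta / (32 * kappa ^+ 2)) (1 / (10 * d1%:R * L)))
  (htheta1 : theta1 = (5 * d1%:R * L + 3 / (2 * alpha) + 3 / 2 * L + d2%:R * L)
                        * d1%:R ^+ 2 * L ^+ 2 * alpha ^+ 2)
  (hmu1 : mu1 = Num.sqrt alpha * eps / (2 * Num.sqrt theta1))
  (hmu2 : mu2 = Num.sqrt alpha * eps / (Num.sqrt (3 * beta) * d2%:R * L)) :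
  (* T(eps) = min{t : E||grad Phi(x_t)|| <= eps} is at most the bound *)
  exists t : nat,
    t%:R <= 4 * (3 * Phi x0 - f x0 y0 - 2 * Phistar) / (alpha * eps ^+ 2) /\
    (expect_dirs t (fun us vs =>
       (enorm (grad Phi (zo_agda f alpha beta mu1 mu2 x0 y0 us vs t).1))%:E)
     <= eps%:E)%E.
Proof.
have [_ hPs] := hPhistar.
have sq0 : 0 < l ^+ 2 / mu by rewrite divr_gt0// exprn_gt0.
have hL' : L = l + l ^+ 2 / mu / 2 by rewrite hL; field; rewrite gt_eqF.
have lL : l <= L by rewrite hL'; lra.
have L0 : 0 < L by lra.
have D10 : (0 : R) < d1%:R by rewrite ltr0n.
have D20 : (0 : R) < d2%:R by rewrite ltr0n.
have [ha1 ha2] : alpha <= beta / (32 * kappa ^+ 2) /\ alpha <= 1 / (10 * d1%:R * L).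
  by apply/andP; rewrite -le_min.
have k0 : 0 < kappa by rewrite hkappa divr_gt0.
have bL : 4 * (beta * d2%:R * L) <= 1.
  by move: hbeta; rewrite ler_pdivlMr ?mulr_gt0//; lra.
have aL : 10 * (alpha * d1%:R * L) <= 1.
  by move: ha2; rewrite ler_pdivlMr ?mulr_gt0//; lra.
have ab : 32 * (alpha * (l ^+ 2 / mu)) <= beta * mu.
  move: ha1; rewrite ler_pdivlMr ?mulr_gt0 ?exprn_gt0// => /(ler_wpM2r (ltW hmu)).
  apply: le_trans; rewrite le_eqVlt; apply/orP; left; apply/eqP.
  by rewrite hkappa; field; rewrite gt_eqF.
(* The summand [3 / (2 alpha)] of [theta1] gives [mu1^2 d1^2 L^2 <= eps^2 / 6], whence the constant
   1/24 in [rho1]. *)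
have th : 3 / 2 * (alpha * (d1%:R ^+ 2 * L ^+ 2)) <= theta1.
  rewrite htheta1.
  have -> : 3 / 2 * (alpha * (d1%:R ^+ 2 * L ^+ 2)) =
      3 / (2 * alpha) * d1%:R ^+ 2 * L ^+ 2 * alpha ^+ 2.
    by field; rewrite gt_eqF.
  rewrite !ler_wpM2r ?sqr_ge0//.
  have h1 : 0 < d1%:R * L by exact: mulr_gt0.
  have h2 : 0 < d2%:R * L by exact: mulr_gt0.
  lra.
have th0 : 0 < theta1.
  by apply: lt_le_trans th; rewrite !mulr_gt0// exprn_gt0.
have mu10 : 0 < mu1 by rewrite hmu1 divr_gt0// mulr_gt0// sqrtr_gt0.
have mu20 : 0 < mu2.
  by rewrite hmu2 divr_gt0 ?mulr_gt0// sqrtr_gt0// mulr_gt0.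
have mu1E : mu1 ^+ 2 * theta1 = alpha * eps ^+ 2 / 4.
  rewrite hmu1 expr_div_n !exprMn !sqr_sqrtr ?ltW//; field; exact: lt0r_neq0.
have mu2E : mu2 ^+ 2 * (beta * (d2%:R ^+ 2 * L ^+ 2)) = alpha * eps ^+ 2 / 3.
  rewrite hmu2 expr_div_n !exprMn !sqr_sqrtr ?mulr_ge0 ?ltW//.
  by field; rewrite !lt0r_neq0.
have l2L2 : l ^+ 2 <= L ^+ 2 by rewrite ler_pXn2r// nnegrE ltW.
have rho1 : (d1%:R * l * mu1 / 2) ^+ 2 <= eps ^+ 2 / 24.
  rewrite -(ler_pM2l halpha0).
  have -> : alpha * (d1%:R * l * mu1 / 2) ^+ 2 =
    mu1 ^+ 2 / 4 * alpha * d1%:R ^+ 2 * l ^+ 2 by field.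
  apply: (@le_trans _ _ (mu1 ^+ 2 / 4 * alpha * d1%:R ^+ 2 * L ^+ 2)).
    by rewrite ler_wpM2l// !mulr_ge0 ?sqr_ge0// ?divr_ge0 ?sqr_ge0 ?ltW.
  have := ler_wpM2l (sqr_ge0 mu1) th; rewrite mu1E; lra.
have rho2 : beta * (d2%:R * l * mu2 / 2) ^+ 2 <= alpha * eps ^+ 2 / 12.
  have -> : beta * (d2%:R * l * mu2 / 2) ^+ 2 =
    mu2 ^+ 2 / 4 * beta * d2%:R ^+ 2 * l ^+ 2 by field.
  apply: (@le_trans _ _ (mu2 ^+ 2 / 4 * beta * d2%:R ^+ 2 * L ^+ 2)).
    by rewrite ler_wpM2l// !mulr_ge0 ?sqr_ge0// ?divr_ge0 ?sqr_ge0 ?ltW.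
  by move: mu2E; lra.
(* Chosen so that [7/10 alpha c = 1 / (2 eps)], matching [P <= P^2 / (2 eps) + eps / 2]. *)
pose c := (7 / 5 * alpha * eps)^-1.
have c0 : 0 < c by rewrite invr_gt0 !mulr_gt0.
pose V := lyapunov f Phi Phistar.
have V0 x y : 0 <= V x y by exact: lyapunov_ge0.
pose zo := zo_agda f alpha beta mu1 mu2 x0 y0.
pose a t := expect_dirs t (fun us vs => (c * V (zo us vs t).1 (zo us vs t).2)%:E).
pose p t := expect_dirs t (fun us vs => (enorm (grad Phi (zo us vs t).1))%:E).
have a0 t : (0 <= a t)%E.
  by apply: expect_dirs_ge0 => us vs; rewrite lee_fin mulr_ge0// ltW.
(* Stated with sums only, as the expectations are extended reals and merely superadditive. The
   constant is [9/28 + 1/2 = 23/28]. *)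
have step t : (a t.+1 + p t <= a t + (23 / 28 * eps)%:E)%E.
  apply: le_trans; last first.
    apply: expect_dirsD_cst_le => [us vs|]; last by rewrite mulr_ge0// ltW.
    by rewrite lee_fin mulr_ge0// ltW.
  rewrite {1}/a /p /=.
  apply: le_trans.
    apply: expect_dirsD_ge => us vs; last by rewrite lee_fin enorm_ge0.
    do 2 (apply: sphere_expect_ge0 => ? ?).
    by rewrite lee_fin mulr_ge0// ltW.
  apply: expect_dirs_le => us vs.
    rewrite adde_ge0 ?lee_fin ?enorm_ge0//.
    do 2 (apply: sphere_expect_ge0 => ? ?).
    by rewrite lee_fin mulr_ge0// ltW.
  set x := (zo us vs t).1; set y := (zo us vs t).2.
  apply: (@le_trans _ _ ((c * (V x y - 7 / 10 * alpha * enorm (grad Phi x) ^+ 2 +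
            9 / 20 * alpha * eps ^+ 2))%:E + (enorm (grad Phi x))%:E)%E).
    apply: leeD => //.
    apply: le_trans (agda_step hdx hdy hPhi hmu hPL hl hLx hLy hPs x y hd1 hd2
      (ltW c0) halpha0 hbeta0 mu10 mu20 hL' bL aL ab rho1 rho2).
    apply: sphere_expect_le => u _.
      by apply: sphere_expect_ge0 => v _; rewrite lee_fin mulr_ge0// ltW.
    apply: sphere_expect_le => v _; first by rewrite lee_fin mulr_ge0// ltW.
    by rewrite /zo /= !zo_agda_upd// /upd eqxx.
  rewrite -!EFinD lee_fin; set P := enorm _.
  have -> : c * (V x y - 7 / 10 * alpha * P ^+ 2 + 9 / 20 * alpha * eps ^+ 2) =
     c * V x y - P ^+ 2 / (2 * eps) + 9 / 28 * eps.
    by rewrite /c; field; rewrite !lt0r_neq0.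
  have : P <= P ^+ 2 / (2 * eps) + eps / 2.
    rewrite -subr_ge0.
    have -> : P ^+ 2 / (2 * eps) + eps / 2 - P = (P - eps) ^+ 2 / (2 * eps).
      by field; rewrite gt_eqF.
    by rewrite divr_ge0 ?sqr_ge0// mulr_ge0// ltW.
  lra.
apply: contrapT => Hno.
pose B := 4 * (3 * Phi x0 - f x0 y0 - 2 * Phistar) / (alpha * eps ^+ 2).
have B0 : 0 <= B.
  rewrite divr_ge0//; last by rewrite mulr_ge0 ?sqr_ge0// ltW.
  by rewrite mulr_ge0//; have := V0 x0 y0; rewrite /V /lyapunov; lra.
have big t : (t <= Num.truncn B)%N -> (eps%:E <= p t)%E.
  move=> tB; rewrite leNgt; apply/negP => pe; apply: Hno; exists t; split.
    by rewrite -/B; apply: le_trans (_ : (Num.truncn B)%:R <= _); rewrite ?ler_nat// truncn_le.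
  exact: ltW.
(* Each index with [p t >= eps] lowers [a] by at least [eps - 23/28 eps = 5/28 eps]. There are
   [truncn B + 1] such indices, counting 0, and this number strictly exceeds [B], while [c V x0 y0]
   is exactly [B] times [5/28 eps]. *)
have sum t : (t <= (Num.truncn B).+1)%N ->
    (a t + (t%:R * (5 / 28 * eps))%:E <= (c * V x0 y0)%:E)%E.
  elim: t => [|t IH] tB; first by rewrite mul0r adde0.
  have := IH (ltnW tB); apply: le_trans.
  have := le_trans (leeD2l (a t.+1) (big t tB)) (step t).
  have := a0 t.+1; have := a0 t.
  case: (a t.+1) => [s| |]//; case: (a t) => [r| |]//= _ _; rewrite ?leey//.
  by rewrite -!EFinD !lee_fin -natr1; lra.
have := le_trans (leeDr _ (a0 _)) (sum _ (leqnn _)).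
rewrite lee_fin leNgt => /negP; apply.
have := truncnS_gt B; set T := (_.+1)%:R => BT.
have -> : c * V x0 y0 = B * (5 / 28 * eps).
  by rewrite /c /B /V /lyapunov; field; rewrite !lt0r_neq0.
by rewrite ltr_pM2r// mulr_gt0.
Qed.
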